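(* Let $p\in(1,+\infty)$ and suppose that the system is $T$-periodic for some $T>0$. Let $P_0:=P_{0,T|\mathrm{Im}\,\Pi_0}:\mathrm{Im}\,\Pi_0\to \mathrm{Im}\,\Pi_0$, where $\mathrm{Im}\,\Pi_0\subseteq L^p(X,\mu_0)$, and let $R_0$ be the spectral radius of $P_0$. Assume that $R_0>0$ and that all the elements of $\sigma(P_0)$ of modulus $R_0$, if any, are semisimple for $P_0$. Then there exist a constant $C>0$, depending only on the problem's data, and a positive integer $N_0$ such that $$\left\|\left(P_{0,T|\mathrm{Im}\,\Pi_0}\right)^N\right\|\le C\,R_0^N\qquad\forall N\ge N_0,$$ where the norm is the operator norm on $\mathrm{Im}\,\Pi_0$ equipped with the norm of $L^p(X,\mu_0)$.
   Context: $X$ is a separable real Hilbert space with inner product $\langle\cdot,\cdot\rangle_X$ and norm $|\cdot|_X$; $\mathcal L(X)$ is the space of bounded linear operators on $X$. $\{A(t)\}_{t\in\mathbb R}$ is a family of linear operators $A(t):D(A(t))\subseteq X\to X$ generating a strongly continuous evolution operator $\{U(t,s):s\le t\}\subseteq\mathcal L(X)$, i.e. $\partial_tU(t,s)=A(t)U(t,s)$ for $s<t$, $U(t,s)=U(t,r)U(r,s)$ for $s\le r\le t$, $U(\tau,\tau)=I$, and $(t,s)\mapsto U(t,s)x$ is continuous on $\{s\le t\}$ for every $x\in X$. The set $\Omega_U:=\{\omega\in\mathbb R:\exists M>0,\ \|U(t,s)\|_{\mathcal L(X)}\le Me^{\omega(t-s)}\ \forall s\le t\}$ is non-empty and $\omega_0:=\inf\Omega_U<0$.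 $\{B(t)\}_{t\in\mathbb R}\subseteq\mathcal L(X)$ is bounded in operator norm and $t\mapsto B(t)x$ is measurable for every $x\in X$. For $s\le t$ set $Q(t,s):=\int_s^tU(t,r)B(r)B(r)^*U(t,r)^*\,dr$ and $Q(t,-\infty):=\int_{-\infty}^tU(t,r)B(r)B(r)^*U(t,r)^*\,dr$. Standing assumptions: every $Q(t,s)$ is trace class and $\sup_{s\le t}\mathrm{tr}\,Q(t,s)<+\infty$ for every $t$ (which implies that $Q(t,-\infty)$ is trace class); controllability: $\mathrm{Im}\,U(t,s)\subseteq \mathrm{Im}\,Q(t,s)^{1/2}$ for all $s<t$; the measures $\mu_t$ below are non-degenerate. $\mathcal N(a,Q)$ denotes the Gaussian measure on $X$ with mean $a$ and covariance $Q$; $\mu_t:=\mathcal N(0,Q(t,-\infty))$. The Ornstein-Uhlenbeck operators are $[P_{s,t}\varphi](x):=\int_X\varphi(U(t,s)x+y)\,\mathcal N(0,Q(t,s))(dy)$ for $\varphi\in C_b(X)$, $s\le t$. Each $P_{s,t}$ with $s<t$ extends uniquely to a contraction $L^p(X,\mu_t)\to L^p(X,\mu_s)$, still denoted $P_{s,t}$. $T$-periodic means: $A(t+T)=A(t)$ and $B(t+T)=B(t)$ for all $t\in\mathbb R$; consequently $U(t+T,s+T)=U(t,s)$ and $Q(t+T,s+T)=Q(t,s)$ for $s\le t$, and $\mu_{t+T}=\mu_t$. $\Pi_t:L^p(X,\mu_t)\to L^p(X,\mu_t)$ is the projection $\Pi_tf:=f-\int_Xf\,d\mu_t$, so $\mathrm{Im}\,\Pi_t$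 is the closed subspace of functions with zero $\mu_t$-mean; under periodicity $P_{0,T}$ maps $\mathrm{Im}\,\Pi_0$ into itself. Spectral notions for operators on real spaces refer to their complexifications. For a bounded operator $S$ on a Banach space $E$, an isolated point $\lambda$ of the spectrum $\sigma(S)$ is called semisimple for $S$ if it is a first order pole of the resolvent $z\mapsto (zI-S)^{-1}$; equivalently, $\mathrm{Im}(\lambda I-S)$ is closed and $E=\mathrm{Ker}(\lambda I-S)\oplus \mathrm{Im}(\lambda I-S)$. *)

(* Defs.v *)
From HB Require Import structures.
From mathcomp Require Import all_boot all_order all_algebra.
From mathcomp Require Import complex.
From mathcomp Require Import all_classical all_reals all_analysis.
From mathcomp Require Import measurable_realfun.

Set Implicit Arguments.
Unset Strict Implicit.
Unset Printing Implicit Defensive.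
Import Order.TTheory GRing.Theory Num.Theory.
Import numFieldNormedType.Exports.

Local Open Scope classical_set_scope.
Local Open Scope ring_scope.

Section Lp.
Context d (T : measurableType d) (R : realType) (mu : probability T R).
Variables (p : R) (p1 : (1 <= p%:E)%E).

Local Notation L := (LfunType mu p1).

Definition null_Lfun : {pred L} := [pred f : L | `[< f = cst 0 %[ae mu] >]].

Lemma null_LfunP (f : L) : reflect (f = cst 0 %[ae mu]) (f \in null_Lfun).
Proof. exact: asboolP. Qed.

Lemma null_Lfun_zmod : zmod_closed null_Lfun.
Proof.
split; first exact/null_LfunP/aeW.
move=> f g /null_LfunP f0 /null_LfunP g0; apply/null_LfunP.
apply: filterS2 f0 g0 => x /= fx gx _.
by rewrite -[LHS]/(f x - g x) fx// gx// /cst subr0.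
Qed.

HB.instance Definition _ := GRing.isZmodClosed.Build L null_Lfun null_Lfun_zmod.

(* L^p(T, mu): the quotient of the p-integrable functions by the null ones;
   an element is used as a function through a chosen representative. *)
Definition Lp : Type := Quotient.quot null_Lfun.
HB.instance Definition _ := Choice.on Lp.
HB.instance Definition _ := GRing.Zmodule.on Lp.

Definition Lp_class (f : L) : Lp := \pi_(Quotient.quot null_Lfun)%qT f.
Definition Lp_rep (f : Lp) : L := repr (f : Quotient.quot null_Lfun).
Definition Lp_fun (f : Lp) : T -> R := Lp_rep f.
Coercion Lp_fun : Lp >-> Funclass.

Lemma Lp_repK : cancel Lp_rep Lp_class.
Proof. by move=> f; exact: reprK. Qed.

Lemma Lp_classP (f g : L) : Lp_class f = Lp_class g <-> f = g %[ae mu].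
Proof.
have -> : (Lp_class f = Lp_class g) <-> (f - g \in null_Lfun).
  by rewrite Quotient.idealrBE; split=> /eqP.
split=> [/null_LfunP|] h.
  by apply: filterS h => x + _ => /(_ I)/subr0_eq.
apply/null_LfunP; apply: filterS h => x + _ => /(_ I) fx.
by rewrite -[LHS]/(f x - g x) fx subrr.
Qed.

Lemma Lp_eqP (f g : Lp) : f = g <-> f = g %[ae mu].
Proof. by rewrite -{1}(Lp_repK f) -{1}(Lp_repK g); exact: Lp_classP. Qed.

Lemma Lp_class_fun (f : L) : (Lp_class f : Lp) = f %[ae mu].
Proof. by apply/Lp_classP; rewrite Lp_repK. Qed.

Lemma Lp_classD : {morph Lp_class : f g / f + g}.
Proof. by move=> f g; exact: Quotient.pi_add. Qed.

Lemma Lp_funD (f g : Lp) : (f + g : Lp) = f \+ g %[ae mu].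
Proof.
have : f + g = Lp_class (Lp_rep f + Lp_rep g) by rewrite Lp_classD !Lp_repK.
by move: (f + g) => h ->; exact: Lp_class_fun.
Qed.

Definition Lp_scale (a : R) (f : Lp) : Lp := Lp_class (a *: Lp_rep f).

Lemma Lp_classZ a (f : L) : Lp_scale a (Lp_class f) = Lp_class (a *: f).
Proof.
apply/Lp_classP; apply: filterS (Lp_class_fun f) => x fx _.
by rewrite -[LHS]/(a * Lp_class f x) -[RHS]/(a * f x) fx.
Qed.

Lemma Lp_scaleA a b f : Lp_scale a (Lp_scale b f) = Lp_scale (a * b) f.
Proof. by rewrite -(Lp_repK f) !Lp_classZ scalerA. Qed.
Lemma Lp_scale1 : left_id 1 Lp_scale.
Proof. by move=> f; rewrite -(Lp_repK f) !Lp_classZ scale1r. Qed.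
Lemma Lp_scaleDr : right_distributive Lp_scale +%R.
Proof.
move=> a f g; rewrite -(Lp_repK f) -(Lp_repK g) -Lp_classD !Lp_classZ.
by rewrite -Lp_classD scalerDr.
Qed.
Lemma Lp_scaleDl f : {morph Lp_scale^~ f : a b / a + b}.
Proof.
by move=> a b; rewrite -(Lp_repK f) !Lp_classZ scalerDl Lp_classD.
Qed.

HB.instance Definition _ := GRing.Zmodule_isLmodule.Build R Lp
  Lp_scaleA Lp_scale1 Lp_scaleDr Lp_scaleDl.

Lemma Lp_funZ a (f : Lp) : (a *: f : Lp) = a \*: (f : T -> R) %[ae mu].
Proof. by rewrite -[a *: f]/(Lp_scale a f); exact: Lp_class_fun. Qed.

Definition Lp_norm (f : Lp) : R := fine (Lnorm mu p%:E (EFin \o f)).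

Lemma Lp_normE (f : Lp) : (Lp_norm f)%:E = Lnorm mu p%:E (EFin \o f).
Proof. exact: (finite_norm_fine (Lp_rep f)). Qed.

Lemma eq_ae_Lnorm (f g : T -> R) : measurable_fun setT f ->
  measurable_fun setT g -> f = g %[ae mu] ->
  Lnorm mu p%:E (EFin \o f) = Lnorm mu p%:E (EFin \o g).
Proof.
move=> mf mg fg; rewrite unlock; congr (_ `^ _)%E.
have mp (h : T -> R) : measurable_fun setT h ->
    @measurable_fun _ _ T (\bar R) setT (fun x => `|(EFin \o h) x| `^ p)%E.
  move=> mh; rewrite (_ : (fun x => _) = EFin \o (fun x => `|h x| `^ p)).
    apply/measurable_EFinP.
    apply: (@measurableT_comp _ _ _ _ _ _ (@powR R ^~ p)) => //.
    exact: measurableT_comp.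
  by apply/funext => x; rewrite /= -poweR_EFin.
apply: ae_eq_integral => //; [exact: mp|exact: mp|].
by apply: filterS fg => x fg xT /=; rewrite fg.
Qed.

Lemma Lp_fun_measurable (f : Lp) : measurable_fun setT f.
Proof. by rewrite /Lp_fun. Qed.

Lemma Lp_normD (f g : Lp) : Lp_norm (f + g) <= Lp_norm f + Lp_norm g.
Proof.
rewrite -lee_fin EFinD !Lp_normE (@eq_ae_Lnorm (f + g : Lp) (f \+ g)).
- by apply: eminkowski => //; exact: Lp_fun_measurable.
- exact: Lp_fun_measurable.
- by apply: measurable_funD; exact: Lp_fun_measurable.
- exact: Lp_funD.
Qed.

Lemma Lp_normZ a (f : Lp) : Lp_norm (a *: f) = `|a| * Lp_norm f.
Proof.
apply/EFin_inj; rewrite EFinM !Lp_normE -(LnormZ (Lp_rep f)).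
apply: eq_ae_Lnorm; [exact: Lp_fun_measurable| |exact: Lp_funZ].
by apply: measurable_funM => //; exact: Lp_fun_measurable.
Qed.

Lemma Lp_norm0_eq0 (f : Lp) : Lp_norm f = 0 -> f = 0.
Proof.
move=> /(@fine_Lnormr_eq0 _ _ _ mu _ p1 (Lp_rep f)) f0.
have <- : Lp_class 0 = 0 by apply: (addrI (Lp_class 0)); rewrite -Lp_classD !addr0.
by rewrite -(Lp_repK f); exact/Lp_classP.
Qed.

HB.instance Definition _ := Lmodule_isNormed.Build R Lp
  Lp_normD Lp_normZ Lp_norm0_eq0.
End Lp.

Section zero_mean.
Context d (T : measurableType d) (R : realType) (mu : probability T R).
Variables (p : R) (p1 : (1 <= p%:E)%E).
Local Notation Lp := (Lp mu p1).

Definition Lp_mean (f : Lp) : R := \int[mu]_x f x.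

Lemma Lp_integrable (f : Lp) : mu.-integrable setT (EFin \o f).
Proof.
apply/Lfun1_integrable; apply: (Lfun_subset _ p1) (LfunP (Lp_rep f)) => //.
by rewrite [X in X \is a _](@probability_setT _ _ _ mu).
Qed.

Lemma Lp_mean_linear a (f g : Lp) :
  Lp_mean (a *: f + g) = a * Lp_mean f + Lp_mean g.
Proof.
have If := Lp_integrable f; have Ig := Lp_integrable g.
have Iaf : mu.-integrable setT (EFin \o (a \*: (f : T -> R))).
  exact: (integrableZl measurableT a If).
rewrite /Lp_mean -RintegralZl// -RintegralD//; congr fine.
apply: ae_eq_integral => //.
- exact/measurable_EFinP/Lp_fun_measurable.
- apply/measurable_EFinP/measurable_funD; last exact: Lp_fun_measurable.
  by apply: measurable_funM => //; exact: Lp_fun_measurable.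
- apply: filterS2 (Lp_funD (a *: f) g) (Lp_funZ a f) => x + + _.
  by move=> /(_ I) -> /(_ I) /= ->.
Qed.

Definition Lp_cst (c : R) : Lp := Lp_class (Lfun_Sub p1 (Lfun_cst mu c p)).

Lemma Lp_cst_linear a c c' : Lp_cst (a * c + c') = a *: Lp_cst c + Lp_cst c'.
Proof.
rewrite [a *: _]Lp_classZ -Lp_classD; congr (Lp_class _).
by apply/LfuneqP.
Qed.

(* the projection f |-> f - \int f dmu *)
Definition Lp_Pi (f : Lp) : Lp := f - Lp_cst (Lp_mean f).

Lemma Lp_Pi_linear a f g : Lp_Pi (a *: f + g) = a *: Lp_Pi f + Lp_Pi g.
Proof.
by rewrite /Lp_Pi Lp_mean_linear Lp_cst_linear scalerBr opprD addrACA.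
Qed.

Definition ImPi_pred : {pred Lp} := [pred f | `[< range Lp_Pi f >]].

Lemma ImPi_submod : submod_closed ImPi_pred.
Proof.
split=> [|a f g /asboolP[f' _ <-] /asboolP[g' _ <-]]; apply/asboolP.
  exists 0 => //; have := Lp_Pi_linear (- 1) 0 0.
  by rewrite scaler0 addr0 scaleN1r addNr.
by exists (a *: f' + g') => //; rewrite Lp_Pi_linear.
Qed.

HB.instance Definition _ :=
  GRing.isSubmodClosed.Build R Lp ImPi_pred ImPi_submod.

(* Im Pi; by ImPi_predE below, the elements with zero mean *)
Record ImPi := { ImPi_val :> Lp ; _ : ImPi_val \in ImPi_pred }.
HB.instance Definition _ := [isSub for ImPi_val].
HB.instance Definition _ := [Choice of ImPi by <:].
HB.instance Definition _ := [SubChoice_isSubLmodule of ImPi by <:].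

Let nrm (f : ImPi) : R := `|ImPi_val f|.
Let nrmD f g : nrm (f + g) <= nrm f + nrm g.
Proof. exact: ler_normD. Qed.
Let nrmZ a f : nrm (a *: f) = `|a| * nrm f.
Proof. exact: normrZ. Qed.
Let nrm0 f : nrm f = 0 -> f = 0.
Proof. by move=> /normr0_eq0 f0; exact/val_inj. Qed.
HB.instance Definition _ := Lmodule_isNormed.Build R ImPi nrmD nrmZ nrm0.

Lemma ImPi_normE (f : ImPi) : `|f| = `|ImPi_val f|. Proof. by []. Qed.

Lemma Lp_mean_cst c : Lp_mean (Lp_cst c) = c.
Proof.
rewrite /Lp_mean; transitivity (\int[mu]_x (cst c) x); last first.
  by rewrite Rintegral_cst// [X in fine X](@probability_setT _ _ _ mu) mulr1.
congr fine; apply: ae_eq_integral => //.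
- exact/measurable_EFinP/Lp_fun_measurable.
- exact/measurable_EFinP/measurable_cst.
- have := Lp_class_fun (Lfun_Sub p1 (Lfun_cst mu c p)).
  by apply: filterS => x /= + _ => /(_ I) ->.
Qed.

Lemma ImPi_predE f : (f \in ImPi_pred) = (Lp_mean f == 0).
Proof.
apply/asboolP/eqP => [[g _ <-]|f0].
  rewrite /Lp_Pi addrC -scaleN1r Lp_mean_linear Lp_mean_cst.
  by rewrite mulN1r addNr.
exists f => //; rewrite /Lp_Pi f0; have := Lp_cst_linear (-1) 0 0.
by rewrite mulr0 addr0 scaleN1r addNr => ->; rewrite subr0.
Qed.
End zero_mean.

Lemma exponent_ge1 (R : realType) (p : R) : 1 < p -> (1 <= p%:E)%E.
Proof. by move=> /ltW; rewrite lee_fin. Qed.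

Section operators.
Context {R : realType}.

(* +oo on unbounded operators *)
Definition opnorm (V W : normedModType R) (T : V -> W) : \bar R :=
  ereal_sup [set (`|T x|)%:E | x in [set x | `|x| <= 1]].

(* E * E is the complexification of the real normed space E, (u, v) standing
   for u + iv.  Its max-norm is not homogeneous over R[i], but it is equivalent
   to every norm of the complexification extending that of E, so boundedness
   and operator-norm convergence are the usual ones. *)
Definition cscale (E : normedModType R) (z : R[i]) (w : E * E) : E * E :=
  (complex.Re z *: w.1 - complex.Im z *: w.2,
   complex.Im z *: w.1 + complex.Re z *: w.2).

Definition complexify (E : normedModType R) (S : E -> E) (w : E * E) : E * E :=
  (S w.1, S w.2).

Local Notation normc := ComplexField.Normc.normc.

Section spectrum.
Variables (E : normedModType R) (S : E -> E).
Local Notation EC := (E * E)%type.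

(* T = (z I - S)^-1, as a bounded operator *)
Definition is_resolvent (z : R[i]) (T : {linear EC -> EC}) : Prop :=
  let D w := cscale z w - complexify S w in
  [/\ continuous T, cancel T D & cancel D T].

Definition spectrum : set R[i] :=
  [set z | ~ exists T, is_resolvent z T].

Definition spectral_radius : R := sup [set normc z | z in spectrum].

Definition isolated_in_spectrum (l : R[i]) : Prop :=
  spectrum l /\
  exists2 r : R, 0 < r & forall z, 0 < normc (z - l) < r -> ~ spectrum z.

(* (z - l) (z I - S)^-1 has a nonzero limit in operator norm as z -> l *)
Definition first_order_pole (l : R[i]) : Prop :=
  exists P : {linear EC -> EC},
    [/\ continuous P, exists w, P w != 0 &
      forall e : R, 0 < e -> exists2 r : R, 0 < r &
        forall z T, 0 < normc (z - l) < r -> is_resolvent z T ->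
          (opnorm (fun w => (cscale (z - l) (T w) - P w)%R) <= e%:E)%E].

Definition semisimple (l : R[i]) : Prop :=
  isolated_in_spectrum l /\ first_order_pole l.
End spectrum.
End operators.

Section hilbert.
Context {R : realType} {X : completeNormedModType R}.
Variable ip : {dot X for @idfun R}.

Definition adjoint (T : X -> X) (y : X) : X :=
  xget 0 [set z | forall x, ip (T x) y = ip x z].

(* \int_D F(r) dr; the weak integral, which for separable X is the Bochner
   integral as soon as |F| is integrable *)
Definition vintegral (D : set R) (F : R -> X) : X :=
  xget 0 [set v | forall y,
    lebesgue_measure.-integrable D (fun r => (ip (F r) y)%:E) /\
    ip v y = \int[lebesgue_measure]_(r in D) ip (F r) y].

Definition orthonormal_basis (e : set X) : Prop :=
  [/\ forall x, e x -> ip x x = 1,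
      forall x y, e x -> e y -> x != y -> ip x y = 0 &
      forall x, (forall y, e y -> ip x y = 0) -> x = 0].

(* T = \sum_n <_, a_n> b_n with \sum_n |a_n| |b_n| finite *)
Definition trace_class (T : X -> X) : Prop :=
  exists a b : nat -> X,
    (\sum_(0 <= n <oo) (`|a n| * `|b n|)%:E < +oo)%E /\
    forall x, series (fun n => ip x (a n) *: b n) @ \oo --> T x.

(* the trace of a nonnegative operator, computed in the orthonormal basis e *)
Definition trace (e : set X) (T : X -> X) : \bar R :=
  (\esum_(x in e) (ip (T x) x)%:E)%E.

(* S = T^(1/2), the nonnegative self-adjoint square root *)
Definition is_sqrt (T : X -> X) (S : {linear X -> X}) : Prop :=
  [/\ continuous S,
      forall x y, ip (S x) y = ip x (S y),
      forall x, 0 <= ip (S x) x &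
      forall x, S (S x) = T x].

Definition borel : Type := g_sigma_algebraType (@open X).
HB.instance Definition _ := Measurable.on borel.

(* N = N(a, Q), through the real and imaginary parts of the characteristic
   functional E[exp(i <y, h>)] = exp(i <a, h> - <Q h, h> / 2) *)
Definition is_gaussian (a : X) (Q : X -> X) (N : probability borel R) : Prop :=
  forall h : X,
    \int[N]_y cos (ip y h) = expR (- (ip (Q h) h) / 2) * cos (ip a h) /\
    \int[N]_y sin (ip y h) = expR (- (ip (Q h) h) / 2) * sin (ip a h).

(* the default value is only taken when Q is not a nonnegative self-adjoint
   trace class operator *)
Definition gaussian (a : X) (Q : X -> X) : probability borel R :=
  xget [the probability borel R of dirac (0 : borel)]
    [set N | is_gaussian a Q N].

(* Only the operators U t s with s <= t are constrained. *)
Definition is_evolution (DA : R -> set X) (A : R -> X -> X)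
    (U : R -> R -> {linear X -> X}) : Prop :=
  [/\ forall s t, s <= t -> continuous (U t s),
      forall s t x, s < t ->
        DA t (U t s x) /\ is_derive t 1 (fun t' => U t' s x) (A t (U t s x)),
      forall s r t x, s <= r -> r <= t -> U t s x = U t r (U r s x),
      forall t x, U t t x = x &
      forall x, {within [set ts : R * R | ts.2 <= ts.1],
        continuous (fun ts => U ts.1 ts.2 x)}].

Definition growth_rates (U : R -> R -> {linear X -> X}) : set R :=
  [set w | exists2 M : R, 0 < M & forall s t, s <= t ->
    (opnorm (U t s) <= (M * expR (w * (t - s)))%:E)%E].

Section covariance.
Variables (U : R -> R -> {linear X -> X}) (B : R -> {linear X -> X}).

Let dens (t r : R) (x : X) : X :=
  U t r (B r (adjoint (B r) (adjoint (U t r) x))).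

Definition cov (t s : R) (x : X) : X := vintegral `[s, t] (fun r => dens t r x).

Definition cov_inf (t : R) (x : X) : X :=
  vintegral `]-oo, t] (fun r => dens t r x).

Definition OU_measure (t : R) : probability borel R := gaussian 0 (cov_inf t).

Definition OU (s t : R) (phi : X -> R) (x : X) : R :=
  \int[gaussian 0 (cov t s)]_y phi (U t s x + y).

(* P is the contraction L^p(X, mu_t) -> L^p(X, mu_s) extending the
   Ornstein-Uhlenbeck operator P_{s,t} from C_b(X) *)
Definition is_OU_extension (p : R) (p1 : (1 <= p%:E)%E) (s t : R)
    (P : {linear Lp (OU_measure t) p1 -> Lp (OU_measure s) p1}) : Prop :=
  (opnorm P <= 1)%E /\
  forall phi : X -> R, continuous phi -> bounded_fun phi ->
    forall f : Lp (OU_measure t) p1, f = phi %[ae OU_measure t] ->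
      (P f : Lp (OU_measure s) p1) = OU s t phi %[ae OU_measure s].

(* S is the restriction of P : L^p(X, mu_t) -> L^p(X, mu_s) to Im Pi_s when
   mu_t = mu_s.  The two spaces then have the same elements but are distinct
   types, so f is identified with the g that equals it almost everywhere. *)
Definition is_restriction (p : R) (p1 : (1 <= p%:E)%E) (s t : R)
    (P : {linear Lp (OU_measure t) p1 -> Lp (OU_measure s) p1})
    (S : {linear ImPi (OU_measure s) p1 -> ImPi (OU_measure s) p1}) : Prop :=
  forall (f : ImPi (OU_measure s) p1) (g : Lp (OU_measure t) p1),
    g = ImPi_val f %[ae OU_measure s] ->
    (P g : Lp (OU_measure s) p1) = ImPi_val (S f) %[ae OU_measure s].
End covariance.

(* A centred Gaussian measure is non-degenerate when its covariance operator is
   injective (mu_nondegenerate). *)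
Record standing_assumptions (DA : R -> set X) (A : R -> X -> X)
    (U : R -> R -> {linear X -> X}) (B : R -> {linear X -> X}) : Prop := {
  ip_norm : forall x, ip x x = `|x| ^+ 2;
  separable : exists2 D : set X, countable D & dense D;
  domA_linear : forall t, DA t 0 /\
    forall a x y, DA t x -> DA t y -> DA t (a *: x + y);
  A_linear : forall t a x y, DA t x -> DA t y ->
    A t (a *: x + y) = a *: A t x + A t y;
  U_evolution : is_evolution DA A U;
  growth_nonempty : growth_rates U !=set0;
  growth_neg : (ereal_inf (EFin @` growth_rates U) < 0)%E;
  B_bounded : exists K : R, forall t, (opnorm (B t) <= K%:E)%E;
  B_measurable : forall x, measurable_fun setT (fun t => B t x : borel);
  Q_trace_class : forall s t, s <= t -> trace_class (cov U B t s);
  Q_trace_bounded : forall t e, orthonormal_basis e ->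
    (ereal_sup [set trace e (cov U B t s) | s in [set s | (s <= t)%R]] < +oo)%E;
  controllability : forall s t, s < t -> exists2 S : {linear X -> X},
    is_sqrt (cov U B t s) S & range (U t s) `<=` range S;
  mu_nondegenerate : forall t x, cov_inf U B t x = 0 -> x = 0
}.

(* The family A determines the evolution operator that it generates, so that
   U inherits the periodicity of A; this consequence is recorded in per_U. *)
Record periodic_system (DA : R -> set X) (A : R -> X -> X)
    (U : R -> R -> {linear X -> X}) (B : R -> {linear X -> X}) (T : R)
    : Prop := {
  per_DA : forall t, DA (t + T) = DA t;
  per_A : forall t x, DA t x -> A (t + T) x = A t x;
  per_B : forall t x, B (t + T) x = B t x;
  per_U : forall s t x, s <= t -> U (t + T) (s + T) x = U t s x
}.
End hilbert.

(* Main.v *)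
Require Import Defs.
From HB Require Import structures.
From mathcomp Require Import all_boot all_order all_algebra.
From mathcomp Require Import complex.
From mathcomp Require Import all_classical all_reals all_analysis.
From mathcomp Require Import measurable_realfun.
From mathcomp Require Import lra.
From mathcomp Require Import cyclic separable cyclotomic.

Set Implicit Arguments.
Unset Strict Implicit.
Unset Printing Implicit Defensive.
Import Order.TTheory GRing.Theory Num.Theory.
Import numFieldNormedType.Exports.
Local Open Scope classical_set_scope.
Local Open Scope ring_scope.

(** The measures [mu_0] and [mu_T] coincide: the covariance at time [T] is the
    integral at time [0] of the same integrand, translated by the period
    ([cov_inf_periodic]).  The Ornstein-Uhlenbeck contraction from L^p(mu_T) to
    L^p(mu_0) is therefore a contraction of one space, so that [P0] is a bounded
    operator ([restriction_contraction]) on a space that is complete by the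
    Riesz-Fischer theorem ([ImPi_complete]).  Everything else is spectral theory
    of one bounded operator [S] on a Banach space [E], with spectral radius
    [rho > 0] ([power_bound_spectral_radius]).

    The complexification [a] of [S] is an element of the ring of bounded
    complex-linear operators on [E * E].  The textbook proof would write the
    powers of [a] as Cauchy integrals of the resolvent.  Contour integrals are
    avoided by averaging the resolvent over roots of unity, an idea of Rickart:
    if [w] runs through the [n]-th roots of unity, then the mean of
    [(1 - w z a)^-1] is [(1 - z^n a^n)^-1] ([resolvent_average]).  When [z - a]
    is invertible for every [`|z| >= rho], the resolvent [(1 - z a)^-1] is
    Lipschitz on the closed disc of radius [1 / rho], hence so are its averages,
    uniformly in [n].  They are close to [1] as soon as [z^n a^n] is small, and
    conversely [z^n a^n] is bounded as soon as they are close to [1]; so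
    boundedness of [r^n a^n] in [n] propagates from [r = 0] to [r = 1 / rho] in
    finitely many steps ([rickart]).

    The spectrum may meet the circle [`|z| = rho], but only in isolated points,
    hence in finitely many ([isolated_finite]).  At each of them, the limit [P]
    of [(z - l) (z - a)^-1] is a projection with [a P = P a = l P], and [l - a]
    is invertible on the range of [1 - P] ([limit_resolvent_projection]).
    Replacing [a] by [a - l P] removes [l] from the spectrum, keeps the other
    points of the circle and their projections, and changes the powers only by
    [l^n P], whose norm is of order [rho^n] ([power_bound_deflate]).  Once the
    circle is free of spectrum, [rickart] applies. *)

Local Notation normc := ComplexField.Normc.normc.
Local Notation cscale := Defs.cscale.

(** * The complex plane *)

Section complex_plane.
Variable R : realType.
Implicit Types (z w : R[i]) (r : R).

Lemma normc_ge0 z : 0 <= normc z.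
Proof. by case: z => x y; exact: sqrtr_ge0. Qed.

Lemma normcX z n : normc (z ^+ n) = normc z ^+ n.
Proof.
elim: n => [|n ih]; first by rewrite !expr0 ComplexField.Normc.normc1.
by rewrite !exprS ComplexField.Normc.normcM ih.
Qed.

Lemma normc_real r : normc r%:C%C = `|r|.
Proof. by rewrite /= expr0n /= addr0 sqrtr_sqr. Qed.

Lemma normcB z w : normc (z - w) = normc (w - z).
Proof. by rewrite -normcN opprB. Qed.

Lemma normc_le_ReIm z : normc z <= `|complex.Re z| + `|complex.Im z|.
Proof.
case: z => x y /=; rewrite -(@ler_pXn2r _ 2) ?nnegrE ?sqrtr_ge0 ?addr_ge0 //.
rewrite sqr_sqrtr ?addr_ge0 ?sqr_ge0 // sqrrD !real_normK ?num_real //.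
by rewrite lerD2r lerDl mulrn_wge0 // mulr_ge0.
Qed.

Lemma Re_le_normc z : `|complex.Re z| <= normc z.
Proof.
case: z => x y /=; rewrite -sqrtr_sqr ler_sqrt ?addr_ge0 ?sqr_ge0 //.
by rewrite lerDl sqr_ge0.
Qed.

Lemma Im_le_normc z : `|complex.Im z| <= normc z.
Proof.
case: z => x y /=; rewrite -sqrtr_sqr ler_sqrt ?addr_ge0 ?sqr_ge0 //.
by rewrite lerDr sqr_ge0.
Qed.

(** Compactness of the closed disc, in terms of open discs whose radius depends
    on the centre. *)
Lemma closed_disc_finite_cover (rho : R) (r : R[i] -> R) :
  (forall z, normc z <= rho -> 0 < r z) ->
  exists s : seq R[i], forall z, normc z <= rho ->
    exists l, [/\ l \in s, normc l <= rho & normc (z - l) < r l].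
Proof.
move=> r0.
(* The square around the disc is compact; its points outside the disc get small
   balls that miss the disc, so they never serve in the cover. *)
pose e l := (if normc l <= rho then r l else normc l - rho) / 2.
have e0 l : 0 < e l.
  rewrite /e; case: ifPn => [/r0|]; first by lra.
  by rewrite -ltNge; lra.
pose U (l : R[i]) : set (R * R) := ball (complex.Re l, complex.Im l) (e l).
pose K := `[- rho, rho] `*` `[- rho, rho].
have cK : compact K by apply: compact_setX; exact: segment_compact.
(* Convergence along finite lists of centres, ordered by inclusion, turns the
   near-covering form of compactness into a finite subcover. *)
pose F : set_system (seq R[i]) :=
  [set A | exists s0 : seq R[i], forall s : seq R[i], {subset s0 <= s} -> A s].
have FF : Filter F.
  split; first by exists [::].
    move=> A B [s As] [s' Bs']; exists (s ++ s') => t st.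
    by split; [apply: As|apply: Bs'] => l ls; apply: st;
      rewrite mem_cat ls ?orbT.
  by move=> A B AB [s As]; exists s => t /As/AB.
pose P (s : seq R[i]) (p : R * R) := exists2 l, l \in s & U l p.
have [p Kp|s0 sK] := (compact_near_coveringP K).1 cK _ F P FF.
  pose l : R[i] := (p.1 +i* p.2)%C.
  exists (U l, [set s : seq R[i] | l \in s]).
    split; last by exists [:: l] => s; apply; exact: mem_head.
    by rewrite /U -surjective_pairing; exact: nbhsx_ballx.
  by case=> q s [/= Uq ls]; exists l.
exists s0 => z zr.
have [||l ls] := sK s0 _ (complex.Re z, complex.Im z) => //.
  by split; rewrite /= in_itv /= -ler_norml; apply: le_trans zr;
    [exact: Re_le_normc|exact: Im_le_normc].
rewrite /U /ball/= /prod_ball /= => -[]; rewrite /ball /= => lx ly.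
have zl : normc (z - l) < 2 * e l.
  rewrite normcB; apply: le_lt_trans (normc_le_ReIm _) _.
  rewrite [complex.Re _]raddfB [complex.Im _]raddfB /=; lra.
exists l; split => //.
  rewrite leNgt; apply/negP => rl; move: zl.
  rewrite /e leNgt rl /= mulrC divfK // normcB => zl.
  have := @le_normcD _ (l - z) z; rewrite subrK /=; lra.
move: zl; rewrite /e; case: ifPn; first by rewrite mulrC divfK.
rewrite -ltNge => rl; rewrite mulrC divfK // normcB => zl.
have := @le_normcD _ (l - z) z; rewrite subrK /=; lra.
Qed.

Lemma complex_prim_root n : (0 < n)%N -> exists w : R[i], n.-primitive_root w.
Proof.
move=> n0; pose p : {poly R[i]} := 'X^n - 1.
have [r Dp] := closed_field_poly_normal p.
rewrite (monicP _) ?monicXnsubC // scale1r in Dp.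
have rn1 : all n.-unity_root r by apply/allP=> z; rewrite -root_prod_XsubC -Dp.
have sr : (n < (size r).+1)%N.
  by rewrite -(size_prod_XsubC r id) -Dp size_XnsubC.
have [|z] := hasP (has_prim_root n0 rn1 _ sr); last by exists z.
by rewrite -separable_prod_XsubC -Dp separable_Xn_sub_1 // pnatr_eq0 -lt0n.
Qed.

Lemma normc_unity n w : (0 < n)%N -> w ^+ n = 1 -> normc w = 1.
Proof.
move=> n0 /(congr1 (@ComplexField.Normc.normc R)).
rewrite normcX ComplexField.Normc.normc1.
by move=> /eqP; rewrite pexpr_eq1 ?normc_ge0 // => /eqP.
Qed.

(** A geometric sum with ratio [w ^+ j], which is different from [1]. *)
Lemma sum_prim_root n w j : n.-primitive_root w -> (0 < j < n)%N ->
  \sum_(k < n) (w ^+ k) ^+ j = 0.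
Proof.
move=> pw /andP[j0 jn].
have wj : w ^+ j - 1 != 0.
  rewrite subr_eq0 -(prim_order_dvd pw); apply/negP => /dvdn_leq.
  by rewrite j0 leqNgt jn => /(_ isT).
apply: (mulfI wj); rewrite mulr0.
under eq_bigr do rewrite -exprM mulnC exprM.
by rewrite -subrX1 -exprM mulnC exprM (prim_expr_order pw) expr1n subrr.
Qed.

End complex_plane.

(** * Banach rings over the complex numbers *)

Section inverses.
Variable B : pzRingType.
Implicit Types a b t : B.

Definition inverse a t := a * t = 1 /\ t * a = 1.
Definition invertible a := exists t, inverse a t.

Lemma inverse_comm a t b : inverse a t -> a * b = b * a -> t * b = b * t.
Proof.
move=> [ta at1] ab; have := congr1 (fun x => t * x * t) ab.
by rewrite !mulrA at1 mul1r -!mulrA ta mulr1.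
Qed.

Lemma invertibleM a b : invertible a -> invertible b -> invertible (a * b).
Proof.
move=> [t [at1 ta]] [u [bu ub]]; exists (u * t); split.
  by rewrite mulrA -(mulrA a) bu mulr1.
by rewrite mulrA -(mulrA u) ta mulr1.
Qed.

End inverses.

(** What the spectral arguments need from a complex Banach algebra.  The scalars
    come as a central ring morphism [sc] because the ring of operators on the
    zero space is trivial.  The factor [2] in [nrmZ] accounts for the max-norm
    on [E * E], which is not homogeneous for complex scalars; completeness only
    enters through [neumann]. *)
Record complex_banach_norm (R : realType) (B : pzRingType)
    (sc : {rmorphism R[i] -> B}) (nrm : B -> R) : Prop := ComplexBanachNorm {
  sc_central : forall z a, sc z * a = a * sc z;
  nrm_ge0 : forall a, 0 <= nrm a;
  nrm_eq0 : forall a, nrm a = 0 -> a = 0;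
  nrm1 : nrm 1 <= 1;
  nrmN : forall a, nrm (- a) = nrm a;
  nrmD : forall a b, nrm (a + b) <= nrm a + nrm b;
  nrmM : forall a b, nrm (a * b) <= nrm a * nrm b;
  nrmZ : forall z a, nrm (sc z * a) <= 2 * normc z * nrm a;
  neumann : forall b, nrm b <= 1 / 2 -> invertible (1 - b) }.

Section banach_ring.
Variables (R : realType) (B : pzRingType) (sc : {rmorphism R[i] -> B}).
Variables (nrm : B -> R) (hB : complex_banach_norm sc nrm).
Implicit Types (a b t P : B) (z l w : R[i]).

Let scC := sc_central hB.
Let nrm_ge0 := nrm_ge0 hB.
Let nrmD := nrmD hB.
Let nrmN := nrmN hB.
Let nrmM := nrmM hB.
Let nrmZ := nrmZ hB.

Lemma nrm0 : nrm 0 = 0.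
Proof.
apply/eqP; rewrite eq_le nrm_ge0 andbT.
have := nrmZ 0 0; rewrite mulr0 ComplexField.Normc.normc0.
by rewrite mulr0 mul0r.
Qed.

Lemma nrmB a b : nrm (a - b) <= nrm a + nrm b.
Proof. by rewrite -(nrmN b); exact: nrmD. Qed.

Lemma nrm_sum n (g : nat -> B) :
  nrm (\sum_(k < n) g k) <= \sum_(k < n) nrm (g k).
Proof.
elim: n => [|n ih]; first by rewrite !big_ord0 nrm0.
by rewrite !big_ord_recr /=; apply: le_trans (nrmD _ _) _; rewrite lerD2r.
Qed.

(** The form in which limits in norm yield identities in the ring. *)
Lemma nrm_eq0_small a (K : R) :
  (forall e, 0 < e -> nrm a <= e * K) -> a = 0.
Proof.
move=> h; apply: (nrm_eq0 hB); apply/eqP; rewrite eq_le nrm_ge0 andbT.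
apply/ler_addgt0Pl => e e0; rewrite addr0.
have K0 : 0 < `|K| + 1 by rewrite ltr_wpDl.
apply: le_trans (h (e / (`|K| + 1)) _) _; first by rewrite divr_gt0.
rewrite -mulrA; apply: ler_piMr; first exact: ltW.
rewrite mulrC ler_pdivrMr // mul1r.
by apply: le_trans (ler_norm _) _; rewrite lerDl.
Qed.

Lemma invertible_sc z : z != 0 -> invertible (sc z).
Proof.
move=> z0; exists (sc z^-1); split; rewrite -rmorphM ?mulVf ?mulfV //;
  exact: rmorph1.
Qed.

Lemma invertible_near a : invertible a ->
  exists2 e, 0 < e & forall b, nrm b <= e -> invertible (a - b).
Proof.
move=> ia; have [t [at1 ta]] := ia.
have t0 : 0 < nrm t + 1 by rewrite ltr_wpDl.
exists (1 / 2 / (nrm t + 1)); first by rewrite divr_gt0.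
move=> b be; have -> : a - b = a * (1 - t * b).
  by rewrite mulrBr mulr1 mulrA at1 mul1r.
apply: (invertibleM ia); apply: (neumann hB).
apply: le_trans (nrmM _ _) _; move: be; rewrite ler_pdivlMr // => be.
have := nrm_ge0 b; nra.
Qed.

Lemma resolvent_diff z w a t u :
  inverse (1 - sc z * a) t -> inverse (1 - sc w * a) u ->
  t - u = t * (sc (z - w) * a) * u.
Proof.
move=> [_ ta] [wu _].
have -> : sc (z - w) * a = (1 - sc w * a) - (1 - sc z * a).
  by rewrite rmorphB mulrBl opprB [RHS]addrC addrA subrK.
by rewrite mulrBr mulrBl ta mul1r -mulrA wu mulr1.
Qed.

(** By the resolvent identity, the resolvent at [z] has at most twice the norm
    of the resolvent at [l] when [z] is close to [l]; the closed disc is covered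
    by finitely many such neighbourhoods. *)
Lemma resolvent_bounded a (tau : R) :
  (forall z, normc z <= tau -> invertible (1 - sc z * a)) ->
  exists M, forall z t, normc z <= tau -> inverse (1 - sc z * a) t ->
    nrm t <= M.
Proof.
move=> inv.
have /choice[f fE] z : exists t, normc z <= tau -> inverse (1 - sc z * a) t.
  have [/inv[t ?]|zt] := boolP (normc z <= tau); first by exists t.
  by exists 0 => h; case/negP: zt.
pose d l : R := 1 + 4 * nrm a * nrm (f l).
have d0 l : 0 < d l.
  by rewrite ltr_pwDl // mulr_ge0 // mulr_ge0.
have [|s sP] := @closed_disc_finite_cover R tau (fun l => (d l)^-1).
  by move=> l _; rewrite invr_gt0.
exists (\sum_(l <- s) 2 * nrm (f l)) => z t zt it.
have [l [ls lt zl]] := sP z zt.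
have : nrm t <= 2 * nrm (f l).
  have := resolvent_diff it (fE _ lt) => /(congr1 (fun x => x + f l)).
  rewrite subrK => tE; have := nrm_ge0 t; have := nrm_ge0 (f l).
  have h1 : nrm t <= nrm (t * (sc (z - l) * a) * f l) + nrm (f l).
    by rewrite {1}tE.
  have h2 := nrmM (t * (sc (z - l) * a)) (f l).
  have h3 := nrmM t (sc (z - l) * a).
  have h4 := nrmZ (z - l) a.
  have h5 : normc (z - l) * d l <= 1.
    by rewrite -ler_pdivlMr // div1r ltW.
  move=> fl0 t0; have a0 := nrm_ge0 a.
  have : nrm (sc (z - l) * a) * nrm (f l) <= 1 / 2.
    apply: le_trans (ler_wpM2r fl0 h4) _.
    have := normc_ge0 (z - l); move: h5; rewrite /d; nra.
  move=> h6; have : nrm (t * (sc (z - l) * a) * f l) <= nrm t * (1 / 2).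
    apply: le_trans h2 _; apply: le_trans (ler_wpM2r fl0 h3) _.
    by rewrite -mulrA ler_wpM2l.
  lra.
move=> /le_trans; apply; rewrite big_seq (big_rem l) //= ls lerDl.
by apply: sumr_ge0 => i _; rewrite mulr_ge0.
Qed.

(** Each [(1 - w^k z a)^-1] multiplied by [1 - z^n a^n] is a finite geometric
    sum in [w^k z a]; summing over [k] kills every term but the constant one. *)
Lemma resolvent_average a z n w (f : nat -> B) : (0 < n)%N ->
  n.-primitive_root w ->
  (forall k, (k < n)%N -> inverse (1 - sc (w ^+ k * z) * a) (f k)) ->
  sc n%:R^-1 * (\sum_(k < n) f k) * (1 - sc (z ^+ n) * a ^+ n) = 1.
Proof.
move=> n0 pw fE.
have ac x m : (sc x * a) ^+ m = sc (x ^+ m) * a ^+ m.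
  by rewrite exprMn_comm ?rmorphXn //; exact: scC.
have fk (k : 'I_n) : f k * (1 - sc (z ^+ n) * a ^+ n) =
    \sum_(j < n) sc ((w ^+ k) ^+ j) * (sc (z ^+ j) * a ^+ j).
  have [_ fk1] := fE k (ltn_ord k).
  have -> : z ^+ n = (w ^+ k * z) ^+ n.
    by rewrite exprMn -exprM mulnC exprM (prim_expr_order pw) expr1n mul1r.
  rewrite -ac -opprB subrX1 -mulNr opprB mulrA fk1 mul1r.
  by apply: eq_bigr => j _; rewrite ac exprMn rmorphM mulrA.
rewrite -mulrA mulr_suml (eq_bigr _ (fun k _ => fk k)) exchange_big /=.
case: n n0 pw fE fk => // n _ pw _ _.
rewrite big_ord_recl [X in _ + X]big1 ?addr0 => [|j _]; last first.
  rewrite -mulr_suml -rmorph_sum (sum_prim_root pw); last first.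
    by rewrite lift0 !ltnS leq0n ltn_ord.
  by rewrite [sc _](_ : _ = 0); [exact: mul0r|exact: rmorph0].
under eq_bigr do rewrite !expr0 !rmorph1 !mulr1.
rewrite sumr_const card_ord.
have -> : (1 : B) *+ n.+1 = sc n.+1%:R by rewrite rmorph_nat.
by rewrite -rmorphM mulVf ?pnatr_eq0 // rmorph1.
Qed.

End banach_ring.

(** * Power bounds from averaged resolvents *)

Section rickart.
Variables (R : realType) (B : pzRingType) (sc : {rmorphism R[i] -> B}).
Variables (nrm : B -> R) (hB : complex_banach_norm sc nrm).
Implicit Types (a b t P : B) (z l w : R[i]).

Let scC := sc_central hB.
Let nrm_ge0 := nrm_ge0 hB.
Let nrmD := nrmD hB.
Let nrmN := nrmN hB.
Let nrmM := nrmM hB.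
Let nrmZ := nrmZ hB.

Definition scaled_pow a (r : R) n : B := sc (r%:C%C ^+ n) * a ^+ n.

(** The averages [F] at [r] and [G] at [r'] are inverse to [1 - r^n a^n] and
    [1 - r'^n a^n].  If [r^n a^n] is small then [F] is close to [1]; the
    resolvent being Lipschitz, so is [G] when [r'] is close to [r], uniformly
    in [n]; and [r'^n a^n] can be recovered from [G]. *)
Lemma power_step a (tau M r r' : R) n :
  (forall z, normc z <= tau -> invertible (1 - sc z * a)) ->
  (forall z t, normc z <= tau -> inverse (1 - sc z * a) t -> nrm t <= M) ->
  0 <= r -> r <= r' -> r' <= tau ->
  32 * ((r' - r) * (nrm a * M ^+ 2)) <= 1 -> (0 < n)%N ->
  nrm (scaled_pow a r n) <= 1 / 8 -> nrm (scaled_pow a r' n) <= 1.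
Proof.
move=> inv bnd r0 rr' r't small n0 rn.
have [w pw] := @complex_prim_root R n n0.
have wk k : normc (w ^+ k) = 1.
  by rewrite normcX (normc_unity n0 (prim_expr_order pw)) expr1n.
pose pt (k : nat) (x : R) := w ^+ k * x%:C%C.
have pt_le k x : 0 <= x -> x <= tau -> normc (pt k x) <= tau.
  move=> x0 xt; rewrite ComplexField.Normc.normcM wk mul1r normc_real.
  by rewrite ger0_norm.
have r't0 : 0 <= r' by exact: le_trans rr'.
have rt : r <= tau by exact: le_trans r't.
have /choice[f fE] k := inv _ (pt_le k r r0 rt).
have /choice[g gE] k := inv _ (pt_le k r' r't0 r't).
pose F := sc n%:R^-1 * (\sum_(k < n) f k).
pose G := sc n%:R^-1 * (\sum_(k < n) g k).
have FE : F * (1 - scaled_pow a r n) = 1.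
  by apply: (resolvent_average hB n0 pw) => k _; exact: fE.
have GE : G * (1 - scaled_pow a r' n) = 1.
  by apply: (resolvent_average hB n0 pw) => k _; exact: gE.
(* From F - 1 = F (r^n a^n) and nrm F <= nrm (F - 1) + 1. *)
have F1 : nrm (F - 1) <= 1 / 7.
  have E : F - 1 = F * scaled_pow a r n.
    by rewrite -{1}FE mulrBr mulr1 opprB addrC subrK.
  have h1 : nrm (F - 1) <= nrm F * (1 / 8).
    by rewrite E; apply: le_trans (nrmM _ _) _; rewrite ler_wpM2l.
  have h2 : nrm F <= nrm (F - 1) + 1.
    have := nrmD (F - 1) 1; rewrite subrK; have := nrm1 hB; lra.
  lra.
(* The resolvent identity bounds each summand; averaging and scaling by 1 / n
   cost the factor 2 of the norm axiom. *)
have GF : nrm (G - F) <= 1 / 8.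
  rewrite -mulrBr -sumrB; apply: le_trans (nrmZ _ _) _.
  have -> : normc (n%:R^-1 : R[i]) = n%:R^-1.
    rewrite ComplexField.Normc.normcV -(rmorph_nat (real_complex R)).
    by rewrite normc_real ger0_norm // ler0n.
  have gf (k : 'I_n) : true -> nrm (g k - f k) <= 1 / 16.
    move=> _; rewrite (resolvent_diff (gE k) (fE k)).
    have gM := bnd _ _ (pt_le k r' r't0 r't) (gE k).
    have fM := bnd _ _ (pt_le k r r0 rt) (fE k).
    have h1 := nrmM (g k * (sc (pt k r' - pt k r) * a)) (f k).
    have h2 := nrmM (g k) (sc (pt k r' - pt k r) * a).
    have h3 := nrmZ (pt k r' - pt k r) a.
    have h4 : normc (pt k r' - pt k r) = r' - r.
      rewrite -mulrBr ComplexField.Normc.normcM wk mul1r -rmorphB normc_real.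
      by rewrite ger0_norm // subr_ge0.
    rewrite h4 in h3.
    have f0 := nrm_ge0 (f k); have g0 := nrm_ge0 (g k).
    have s0 := nrm_ge0 (sc (pt k r' - pt k r) * a).
    have M0 : 0 <= M by exact: le_trans gM.
    apply: le_trans h1 _; apply: le_trans (ler_pM _ _ h2 fM) _ => //.
    apply: le_trans (_ : M * (2 * (r' - r) * nrm a) * M <= _).
      by rewrite ler_wpM2r // ler_pM.
    rewrite expr2 in small; lra.
  have h := nrm_sum hB n (fun k => g k - f k).
  have h' := @ler_sum R 'I_n (index_enum _) _ _ _ gf.
  rewrite sumr_const card_ord in h'.
  have n0R : 0 < n%:R :> R by rewrite ltr0n.
  rewrite -mulrA mulrCA mulrC ler_pdivrMr //.
  move: h h'; rewrite -[_ *+ n]mulr_natr; lra.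
(* With e = 1 - G and c = r'^n a^n, the equation (1 - e) (1 - c) = 1 reads
   c = e c - e; as nrm e <= 1 / 2, it bounds c by 1. *)
have e12 : nrm (1 - G) <= 1 / 2.
  have := nrmD (G - F) (F - 1); rewrite addrA subrK.
  by rewrite -(nrmN (1 - G)) opprB; lra.
have E : scaled_pow a r' n = (1 - G) * scaled_pow a r' n - (1 - G).
  rewrite mulrBl mul1r opprB addrC -addrA [RHS]addrA; apply/eqP.
  have := GE; rewrite mulrBr mulr1 => /eqP; rewrite subr_eq => /eqP {1}->.
  by rewrite [1 + _]addrC addrK addrC subrK.
have h1 := nrmB hB ((1 - G) * scaled_pow a r' n) (1 - G).
have h2 := nrmM (1 - G) (scaled_pow a r' n).
have c0 := nrm_ge0 (scaled_pow a r' n).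
rewrite -E in h1.
have : nrm (1 - G) * nrm (scaled_pow a r' n) <=
    1 / 2 * nrm (scaled_pow a r' n) by rewrite ler_wpM2r.
lra.
Qed.

Definition power_bounded a (r : R) :=
  exists C, forall n, r ^+ n * nrm (a ^+ n) <= C.

Lemma eventually_bounded (u : nat -> R) (N : nat) (C : R) :
  (forall n, 0 <= u n) -> (forall n, (N <= n)%N -> u n <= C) ->
  exists D, forall n, u n <= D.
Proof.
move=> u0 uC; exists (`|C| + \sum_(k < N) u k) => n.
have [/uC nC|nN] := leqP N n.
  apply: le_trans nC _; apply: le_trans (ler_norm _) _.
  by rewrite lerDl sumr_ge0.
rewrite (bigD1 (Ordinal nN)) //= addrCA lerDl addr_ge0 //.
by rewrite sumr_ge0.
Qed.

(** [power_step] requires the powers to be small, not only bounded; they tend to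
    zero at any radius [s < r], and [s] is taken at distance [r' - r] below [r]
    when that is nonnegative, whence the factor [64] instead of [32]. *)
Lemma power_bounded_step a (tau M r r' : R) :
  (forall z, normc z <= tau -> invertible (1 - sc z * a)) ->
  (forall z t, normc z <= tau -> inverse (1 - sc z * a) t -> nrm t <= M) ->
  0 <= r -> r <= r' -> r' <= tau ->
  64 * ((r' - r) * (nrm a * M ^+ 2)) <= 1 ->
  power_bounded a r -> power_bounded a r'.
Proof.
move=> inv bnd r0; rewrite le_eqVlt => /predU1P[->//|rr'] r't small [C rC].
have r'0 : 0 < r' by exact: le_lt_trans rr'.
pose s := Num.max 0 (2 * r - r').
have s0 : 0 <= s by rewrite le_max lexx.
have sr' : s <= r' by rewrite ge_max; apply/andP; split; lra.
have smalls : 32 * ((r' - s) * (nrm a * M ^+ 2)) <= 1.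
  have : 0 <= nrm a * M ^+ 2 by rewrite mulr_ge0 ?sqr_ge0.
  have : r' - s <= 2 * (r' - r).
    have : 2 * r - r' <= s by rewrite le_max lexx orbT.
    lra.
  nra.
have [N sN] : exists N, forall n, (N <= n)%N -> (0 < n)%N ->
    nrm (scaled_pow a s n) <= 1 / 8.
  have [r00|rn0] := eqVneq r 0.
    exists 0 => n _ n0; have -> : s = 0.
      by rewrite /s r00 mulr0 sub0r max_l // oppr_le0 ltW.
    rewrite /scaled_pow expr0n eqn0Ngt n0 /= rmorph0 mul0r (nrm0 hB).
    by rewrite divr_ge0.
  have r0' : 0 < r by rewrite lt_neqAle eq_sym rn0.
  have sr : s < r by rewrite gt_max r0' /=; lra.
  have q1 : `|s / r| < 1.
    rewrite ger0_norm; last by rewrite divr_ge0.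
    by rewrite ltr_pdivrMr // mul1r.
  have C0 : 0 <= C by apply: le_trans (rC 0); rewrite mulr_ge0 // expr0.
  have e0 : 0 < (16 * (C + 1))^-1 by rewrite invr_gt0; lra.
  have := @cvgr0_norm_le _ _ _ _ _ _ (cvg_expr q1) _ e0.
  move=> [N _ qN]; exists N => n Nn _.
  have := qN n Nn; rewrite /= ger0_norm ?exprn_ge0 ?divr_ge0 // => qn.
  apply: le_trans (nrmZ _ _) _.
  rewrite normcX normc_real ger0_norm //.
  have -> : s ^+ n = (s / r) ^+ n * r ^+ n.
    by rewrite exprMn exprVn divfK // expf_neq0.
  have := rC n; have := nrm_ge0 (a ^+ n).
  have q0 : 0 <= (s / r) ^+ n by rewrite exprn_ge0 // divr_ge0.
  move=> a0 aC; rewrite -2!mulrA.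
  apply: le_trans (_ : 2 * ((s / r) ^+ n * C) <= _).
    by rewrite ler_pM2l // ler_wpM2l.
  move: ((s / r) ^+ n) q0 qn => q q0 qn.
  have : q * (16 * (C + 1)) <= 1 by rewrite -ler_pdivlMr ?div1r //; lra.
  lra.
apply: (@eventually_bounded _ (maxn N 1) 2) => n.
  by rewrite mulr_ge0 // exprn_ge0 // ltW.
rewrite geq_max => /andP[Nn n0].
have := power_step inv bnd s0 sr' r't smalls n0 (sN n Nn n0).
have r'n : 0 < r' ^+ n by rewrite exprn_gt0.
have E : a ^+ n = sc ((r'%:C%C ^+ n)^-1) * scaled_pow a r' n.
  rewrite /scaled_pow mulrA -rmorphM mulVf ?rmorph1 ?mul1r //.
  by rewrite -rmorphXn; apply/eqP => -[/eqP]; rewrite gt_eqF.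
move=> h; have := nrmZ ((r'%:C%C ^+ n)^-1) (scaled_pow a r' n); rewrite -E.
rewrite ComplexField.Normc.normcV normcX normc_real ger0_norm; last exact: ltW.
move=> h'; rewrite mulrC -ler_pdivlMr //; apply: le_trans h' _.
by rewrite ler_piMr // mulr_ge0 // invr_ge0 ltW.
Qed.

(** The quantitative half of the spectral radius formula, without complex
    integration: power boundedness at radius [0] is trivial and is carried to
    radius [1 / rho] by finitely many steps of a fixed length [d]. *)
Lemma rickart a (rho : R) : 0 < rho ->
  (forall z, rho <= normc z -> invertible (sc z - a)) ->
  exists C, forall n, nrm (a ^+ n) <= C * rho ^+ n.
Proof.
move=> rho0 inv; pose tau := rho^-1.
have tau0 : 0 < tau by rewrite invr_gt0.
have inv' z : normc z <= tau -> invertible (1 - sc z * a).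
  have [->|z0] := eqVneq z 0.
    by exists 1; rewrite rmorph0 mul0r subr0; split; rewrite mulr1.
  have nz0 : 0 < normc z.
    rewrite lt_neqAle normc_ge0 andbT eq_sym; apply: contra_neq z0.
    exact: ComplexField.Normc.eq0_normc.
  move=> zt; have -> : 1 - sc z * a = sc z * (sc z^-1 - a).
    by rewrite mulrBr -rmorphM mulfV // rmorph1.
  apply: invertibleM; first exact: invertible_sc.
  apply: inv; rewrite ComplexField.Normc.normcV.
  by rewrite -[rho]invrK lef_pV2 // posrE.
have [M bnd] := resolvent_bounded hB inv'.
pose L := nrm a * M ^+ 2; have L0 : 0 <= L by rewrite mulr_ge0 // sqr_ge0.
pose d := (64 * (L + 1))^-1; have d0 : 0 < d by rewrite invr_gt0; lra.
have pb k : power_bounded a (Num.min (k%:R * d) tau).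
  elim: k => [|k ih].
    rewrite mul0r min_l ?ltW //.
    apply: (@eventually_bounded _ 1 0) => n.
      by rewrite mulr_ge0 // exprn_ge0.
    by move=> n0; rewrite expr0n eqn0Ngt n0 mul0r.
  apply: power_bounded_step inv' bnd _ _ _ _ ih.
  - by rewrite le_min mulr_ge0 ?ler0n ?ltW.
  - by rewrite le_min2 // ler_pM2r // ler_nat.
  - by rewrite ge_min lexx orbT.
  - have : Num.min (k.+1%:R * d) tau - Num.min (k%:R * d) tau <= d.
      rewrite -natr1 mulrDl mul1r /Order.min.
      by case: ifPn; case: ifPn; rewrite -?leNgt; lra.
    have : 64 * d * (L + 1) = 1.
      by rewrite /d invfM mulrA mulfV // mul1r mulVf // gt_eqF //; lra.
    rewrite -/L; move: (Num.min _ _ - _) => e; nra.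
pose k := (Num.truncn (tau / d)).+1.
have [C rC] := pb k; exists C => n.
have E : Num.min (k%:R * d) tau = tau.
  by rewrite min_r // -ler_pdivrMr // ltW // truncnS_gt.
have := rC n; rewrite E /tau exprVn mulrC ler_pdivrMr //.
by rewrite exprn_gt0.
Qed.

End rickart.

(** * Removing the peripheral spectrum *)

Section deflation.
Variables (R : realType) (B : pzRingType) (sc : {rmorphism R[i] -> B}).
Variables (nrm : B -> R) (hB : complex_banach_norm sc nrm).
Implicit Types (a b t P : B) (z l w : R[i]).

Let scC := sc_central hB.
Let nrm_ge0 := nrm_ge0 hB.
Let nrmD := nrmD hB.
Let nrmN := nrmN hB.
Let nrmM := nrmM hB.
Let nrmZ := nrmZ hB.

Lemma sc_mul_eq0 z b : z != 0 -> sc z * b = 0 -> b = 0.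
Proof.
move=> z0 /(congr1 (fun x => sc z^-1 * x)).
by rewrite mulrA -rmorphM mulVf // rmorph1 mul1r mulr0.
Qed.

(** Relative to the splitting given by [P], the element acts as [b] on one
    summand and as [z] on the other, and is inverted summand by summand. *)
Lemma invertible_split b P z : invertible b -> b * P = P * b -> P * P = P ->
  z != 0 -> invertible (b * (1 - P) + sc z * P).
Proof.
move=> [t bt] bP PP z0; have tP := inverse_comm bt bP; case: bt => bt tb.
have QQ : (1 - P) * (1 - P) = 1 - P.
  by rewrite mulrBr mulr1 mulrBl mul1r PP subrr subr0.
have QP : (1 - P) * P = 0 by rewrite mulrBl mul1r PP subrr.
have PQ : P * (1 - P) = 0 by rewrite mulrBr mulr1 PP subrr.
have Qt : (1 - P) * t = t * (1 - P) by rewrite mulrBl mulrBr mul1r mulr1 tP.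
have Qb : (1 - P) * b = b * (1 - P) by rewrite mulrBl mulrBr mul1r mulr1 bP.
have Q1 : 1 - P + P = 1 by rewrite subrK.
move: (1 - P) QQ QP PQ Qt Qb Q1 => Q QQ QP PQ Qt Qb Q1.
exists (t * Q + sc z^-1 * P); split.
  rewrite mulrDl !mulrDr.
  have -> : b * Q * (t * Q) = Q.
    by rewrite mulrA -(mulrA b) Qt mulrA bt mul1r QQ.
  have -> : b * Q * (sc z^-1 * P) = 0.
    by rewrite scC mulrA -(mulrA b) QP mulr0 mul0r.
  have -> : sc z * P * (t * Q) = 0.
    by rewrite mulrA -(mulrA _ P) -tP !mulrA -mulrA PQ mulr0.
  have -> : sc z * P * (sc z^-1 * P) = P.
    rewrite -mulrA (mulrA P) -(scC _ P) -mulrA PP mulrA -rmorphM mulfV //.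
    by rewrite rmorph1 mul1r.
  by rewrite addr0 add0r Q1.
rewrite mulrDl !mulrDr.
have -> : t * Q * (b * Q) = Q.
  by rewrite mulrA -(mulrA t) Qb mulrA tb mul1r QQ.
have -> : t * Q * (sc z * P) = 0.
  by rewrite scC mulrA -(mulrA t) QP mulr0 mul0r.
have -> : sc z^-1 * P * (b * Q) = 0.
  by rewrite mulrA -(mulrA _ P) -bP !mulrA -mulrA PQ mulr0.
have -> : sc z^-1 * P * (sc z * P) = P.
  rewrite -mulrA (mulrA P) -(scC _ P) -mulrA PP mulrA -rmorphM mulVf //.
  by rewrite rmorph1 mul1r.
by rewrite addr0 add0r Q1.
Qed.

(** [P] is the eigenprojection of the semisimple eigenvalue [l]: adding [l P] to
    [l - a] repairs its kernel. *)
Definition spectral_projection a l P :=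
  [/\ P * P = P, a * P = sc l * P, P * a = sc l * P &
      invertible (sc l - a + sc l * P)].

(** On the range of [P] the element [b] is the scalar [z - l], which the
    summand [l P] turns into [z]; elsewhere nothing changes. *)
Lemma invertible_deflate b P z l : invertible b -> P * P = P ->
  b * P = sc (z - l) * P -> P * b = sc (z - l) * P -> z != 0 ->
  invertible (b + sc l * P).
Proof.
move=> ib PP bP Pb z0.
have -> : b + sc l * P = b * (1 - P) + sc z * P.
  by rewrite mulrBr mulr1 bP rmorphB mulrBl opprB -[RHS]addrA subrK.
by apply: invertible_split => //; rewrite bP.
Qed.

Lemma pow_deflate a l P n : P * P = P -> a * P = sc l * P ->
  P * a = sc l * P ->
  a ^+ n.+1 = (a - sc l * P) ^+ n.+1 + sc (l ^+ n.+1) * P.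
Proof.
move=> PP aP Pa; set a' := a - sc l * P.
have Pa' : P * a' = 0.
  by rewrite mulrBr Pa scC mulrA PP -scC subrr.
have a'P : a' * P = 0 by rewrite mulrBl aP -mulrA PP subrr.
have aE : a = a' + sc l * P by rewrite subrK.
clearbody a'; elim: n => [|n ih]; first by rewrite !expr1.
rewrite exprSr ih mulrDl aE !mulrDr -exprSr.
have -> : a' ^+ n.+1 * (sc l * P) = 0.
  by rewrite scC mulrA exprSr -(mulrA _ a') a'P mulr0 mul0r.
have -> : sc (l ^+ n.+1) * P * a' = 0 by rewrite -mulrA Pa' mulr0.
rewrite addr0 add0r; congr (_ + _).
by rewrite -mulrA (mulrA P) -(scC _ P) -mulrA PP mulrA -rmorphM -exprSr.
Qed.

(** The induction removes one peripheral point [l] with projection [P] at a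
    time.  The projections of distinct points annihilate each other, because
    [(m - l) Q P = 0]; so the remaining points keep theirs. *)
Lemma power_bound_deflate (rho : R) (s : seq R[i]) a : 0 < rho -> uniq s ->
  (forall z, rho <= normc z -> z \notin s -> invertible (sc z - a)) ->
  (forall l, l \in s -> normc l = rho /\ exists P, spectral_projection a l P) ->
  exists C, forall n, nrm (a ^+ n) <= C * rho ^+ n.
Proof.
move=> rho0; elim: s a => [|l s ih] a.
  by move=> _ inv _; apply: (rickart hB rho0) => z /inv; apply.
move=> /= /andP[ls us] inv proj.
have nz z : rho <= normc z -> z != 0.
  by apply: contraTneq => ->; rewrite ComplexField.Normc.normc0 -ltNge.
have [nl [P [PP aP Pa iP]]] := proj l (mem_head _ _).
have E z : sc z - (a - sc l * P) = (sc z - a) + sc l * P.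
  by rewrite opprB addrA addrAC.
have [//|z rz zs|m ms|C aC] := ih (a - sc l * P).
- rewrite E; have [->|zl] := eqVneq z l; first exact: iP.
  apply: (@invertible_deflate _ P z l) => //.
  + by apply: inv; rewrite // inE negb_or zl.
  + by rewrite mulrBl aP -mulrBl -rmorphB.
  + by rewrite mulrBr Pa -scC -mulrBl -rmorphB.
  + exact: nz.
- have [|nm [Q [QQ aQ Qa iQ]]] := proj m; first by rewrite inE ms orbT.
  have ml : m - l != 0.
    by rewrite subr_eq0; apply: contraNneq ls => <-.
  have QP : Q * P = 0.
    apply: (sc_mul_eq0 ml); rewrite rmorphB mulrBl.
    by rewrite !mulrA -Qa scC -!mulrA aP subrr.
  have PQ : P * Q = 0.
    apply: (sc_mul_eq0 ml); rewrite rmorphB mulrBl.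
    by rewrite !mulrA -Pa scC -!mulrA aQ subrr.
  split => //; exists Q; split => //.
  + by rewrite mulrBl aQ -mulrA PQ mulr0 subr0.
  + by rewrite mulrBr Qa (scC l P) mulrA QP mul0r subr0.
  + rewrite E addrAC; apply: (@invertible_deflate _ P m l) => //.
    * by rewrite mulrDl -mulrA QP mulr0 addr0 mulrBl aP -mulrBl -rmorphB.
    * rewrite mulrDr (scC m Q) mulrA PQ mul0r addr0 mulrBr Pa -scC -mulrBl.
      by rewrite -rmorphB.
    * by apply: nz; rewrite nm.
exists (`|C| + 2 * nrm P + 1) => -[|n].
  rewrite expr0 mulr1; apply: le_trans (nrm1 hB) _.
  by rewrite lerDr addr_ge0 // mulr_ge0.
rewrite (pow_deflate _ PP aP Pa); apply: le_trans (nrmD _ _) _.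
have r0 : 0 < rho ^+ n.+1 by rewrite exprn_gt0.
have h1 := aC n.+1; have h2 := nrmZ (l ^+ n.+1) P.
rewrite normcX nl in h2.
have : C * rho ^+ n.+1 <= `|C| * rho ^+ n.+1.
  by rewrite ler_pM2r // ler_norm.
lra.
Qed.

Lemma limit_resolvent_near a l P :
  (exists2 r, 0 < r &
    forall z, 0 < normc (z - l) < r -> invertible (sc z - a)) ->
  (forall e, 0 < e -> exists2 r, 0 < r & forall z t,
    0 < normc (z - l) < r -> inverse (sc z - a) t ->
    nrm (sc (z - l) * t - P) <= e) ->
  forall e, 0 < e -> exists z t, [/\ normc (z - l) <= e,
    inverse (sc z - a) t & nrm (sc (z - l) * t - P) <= e].
Proof.
move=> [r r0 inv] lim e e0; have [q q0 qP] := lim e e0.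
pose d : R := Num.min e (Num.min r q) / 2.
have m0 : 0 < Num.min e (Num.min r q) by rewrite !lt_min e0 r0 q0.
have d0 : 0 < d by rewrite divr_gt0.
have dm : d < Num.min e (Num.min r q) by rewrite /d; lra.
move: dm; rewrite !lt_min => /and3P[de dr dq].
pose z := l + d%:C%C.
have zl : normc (z - l) = d.
  by rewrite /z [l + _]addrC addrK normc_real ger0_norm ?ltW.
have [|t it] := inv z; first by rewrite zl d0 dr.
exists z, t; split=> //; first by rewrite zl ltW.
by apply: qP => //; rewrite zl d0 dq.
Qed.

(** Write [x = (z - l) (z - a)^-1] and [y = x - P], which is small.  The
    relation [(l - a) x = (z - l) (1 - x)] gives [a P = l P] in the limit; then
    [x P = P], and [P P = P] in the limit.  Finally
    [l - a = (z - a) (1 - y) (1 - P)] for a single [z] close to [l], where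
    [1 - y] is invertible by the Neumann series. *)
Lemma limit_resolvent_projection a l P : l != 0 ->
  (exists2 r, 0 < r &
    forall z, 0 < normc (z - l) < r -> invertible (sc z - a)) ->
  (forall e, 0 < e -> exists2 r, 0 < r & forall z t,
    0 < normc (z - l) < r -> inverse (sc z - a) t ->
    nrm (sc (z - l) * t - P) <= e) ->
  spectral_projection a l P.
Proof.
move=> l0 inv lim; have near := limit_resolvent_near inv lim.
pose K := 2 * (2 + nrm P) + nrm (sc l - a).
have K0 : 0 <= K by rewrite addr_ge0 // mulr_ge0 // addr_ge0.
have bound e z t : 0 < e -> e <= 1 -> normc (z - l) <= e ->
    nrm (sc (z - l) * t - P) <= e ->
    2 * normc (z - l) * nrm (1 - sc (z - l) * t) +
      nrm (sc l - a) * nrm (sc (z - l) * t - P) <= e * K.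
  move=> e0 e1 ze; set x := sc (z - l) * t => xe.
  have h1 : nrm (1 - x) <= 2 + nrm P.
    have := nrmB hB 1 x; have := nrmD (x - P) P; rewrite subrK.
    by have := nrm1 hB; lra.
  have h2 : normc (z - l) * nrm (1 - x) <= e * (2 + nrm P).
    by apply: ler_pM => //; exact: normc_ge0.
  have h3 : nrm (sc l - a) * nrm (x - P) <= nrm (sc l - a) * e.
    by rewrite ler_wpM2l.
  rewrite /K; lra.
have small b : (forall e, 0 < e -> e <= 1 -> nrm b <= e * K) -> b = 0.
  move=> bK; apply: (@nrm_eq0_small _ _ _ _ hB _ K) => e e0.
  have [|e1] := leP e 1; first exact: bK.
  by apply: le_trans (bK 1 ltr01 (lexx _)) _; rewrite ler_wpM2r // ltW.
have aP : a * P = sc l * P.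
  apply/esym/eqP; rewrite -subr_eq0 -mulrBl; apply/eqP/small => e e0 e1.
  have [z [t [ze [zt tz] te]]] := near e e0.
  apply: le_trans (bound e z t e0 e1 ze te).
  set x := sc (z - l) * t.
  have -> : (sc l - a) * P = sc (z - l) * (1 - x) - (sc l - a) * (x - P).
    have -> : sc (z - l) * (1 - x) = (sc l - a) * x.
      rewrite /x (scC _ t) [RHS]mulrA -[RHS]scC.
      have -> : sc l - a = (sc z - a) - sc (z - l).
        by rewrite rmorphB opprB [RHS]addrC addrA subrK.
      by rewrite mulrBl zt (scC _ t).
    by rewrite mulrBr opprB [RHS]addrC subrK.
  apply: le_trans (nrmB hB _ _) _; exact: lerD (nrmZ _ _) (nrmM _ _).
have Pa : P * a = sc l * P.
  apply/esym/eqP; rewrite scC -subr_eq0 -mulrBr; apply/eqP/small => e e0 e1.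
  have [z [t [ze [zt tz] te]]] := near e e0.
  apply: le_trans (bound e z t e0 e1 ze te).
  set x := sc (z - l) * t.
  have -> : P * (sc l - a) = sc (z - l) * (1 - x) - (x - P) * (sc l - a).
    have -> : sc (z - l) * (1 - x) = x * (sc l - a).
      rewrite -[in RHS]mulrA.
      have -> : sc l - a = (sc z - a) - sc (z - l).
        by rewrite rmorphB opprB [RHS]addrC addrA subrK.
      by rewrite [t * _]mulrBr tz -scC.
    by rewrite mulrBl opprB [RHS]addrC subrK.
  apply: le_trans (nrmB hB _ _) _; apply: lerD (nrmZ _ _) _.
  by rewrite mulrC; exact: nrmM.
have xP z t : inverse (sc z - a) t -> sc (z - l) * t * P = P.
  move=> [zt tz]; rewrite scC -mulrA rmorphB mulrBl -aP -mulrBl.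
  by rewrite mulrA tz mul1r.
have Px z t : inverse (sc z - a) t -> P * (sc (z - l) * t) = P.
  move=> [zt tz]; rewrite mulrA -scC rmorphB mulrBl -Pa scC -mulrBr.
  by rewrite -mulrA zt mulr1.
have PP : P * P = P.
  apply/esym/eqP; rewrite -subr_eq0; apply/eqP.
  apply: (@nrm_eq0_small _ _ _ _ hB _ (nrm P)) => e e0.
  have [z [t [ze it te]]] := near e e0.
  rewrite -{1}(xP _ _ it) -mulrBl; apply: le_trans (nrmM _ _) _.
  by rewrite ler_wpM2r.
split=> //.
have [z [t [ze it te]]] := near (1 / 2) (divr_gt0 ltr01 (ltr0n _ 2)).
set y := sc (z - l) * t - P in te.
have yP : y * P = 0 by rewrite mulrBl (xP _ _ it) PP subrr.
have Py : P * y = 0 by rewrite mulrBr (Px _ _ it) PP subrr.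
have iM : invertible ((sc z - a) * (1 - y)).
  by apply: invertibleM; [exists t|exact: (neumann hB)].
have zaP : (sc z - a) * P = sc (z - l) * P.
  by rewrite mulrBl aP -mulrBl -rmorphB.
have Pza : P * (sc z - a) = sc (z - l) * P.
  by rewrite mulrBr Pa -scC -mulrBl -rmorphB.
have -> : sc l - a = (sc z - a) * (1 - y) * (1 - P).
  have yE : (1 - y) * (1 - P) = 1 - sc (z - l) * t :> B.
    by rewrite mulrBr mulr1 mulrBl mul1r yP subr0 -addrA -opprD subrK.
  rewrite -mulrA yE mulrBr mulr1 (scC _ t) mulrA it.1 mul1r.
  by rewrite rmorphB opprB [RHS]addrC addrA subrK.
apply: (invertible_split iM) => //.
have -> : (sc z - a) * (1 - y) * P = sc (z - l) * P.
  by rewrite -mulrA [(1 - y) * P]mulrBl mul1r yP subr0.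
by rewrite mulrA Pza -mulrA mulrBr mulr1 Py subr0.
Qed.

(** Every point of the circle has a neighbourhood in which it is the only
    possible singular point of the circle; finitely many of them cover it. *)
Lemma isolated_finite (rho : R) a :
  (forall l, normc l = rho -> ~ invertible (sc l - a) ->
    exists2 r, 0 < r &
      forall z, 0 < normc (z - l) < r -> invertible (sc z - a)) ->
  exists2 s : seq R[i], uniq s & forall z,
    z \in s <-> normc z = rho /\ ~ invertible (sc z - a).
Proof.
move=> iso.
have /choice[r rP] l : exists r : R, normc l <= rho -> 0 < r /\
    forall z, normc z = rho -> normc (z - l) < r -> z != l ->
      invertible (sc z - a).
  have [lr|lr|lr] := ltgtP (normc l) rho; last 2 first.
  - by exists 0.
  - have [il|nil] := pselect (invertible (sc l - a)).
      have [e e0 eP] := invertible_near hB il.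
      exists (e / 2) => _; split=> [|z _ zl _]; first by rewrite divr_gt0.
      have -> : sc z - a = (sc l - a) - sc (l - z).
        by rewrite rmorphB opprB [RHS]addrC addrA subrK.
      apply: eP; rewrite -[sc _]mulr1; apply: le_trans (nrmZ _ _) _.
      rewrite normcB in zl; have := nrm1 hB; have := nrm_ge0 1.
      have := normc_ge0 (z - l); rewrite normcB; nra.
    have [e e0 eP] := iso l lr nil.
    exists e => _; split=> // z _ zl znl; apply: eP; rewrite zl andbT.
    rewrite lt_neqAle normc_ge0 andbT eq_sym; apply: contra_neq znl => zl0.
    by apply/eqP; rewrite -subr_eq0; apply/eqP/ComplexField.Normc.eq0_normc.
  (* Inside the disc, the neighbourhood just has to miss the circle. *)
  exists (rho - normc l) => _; split=> [|z zr zl]; first by rewrite subr_gt0.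
  by have := @le_normcD _ (z - l) l; rewrite subrK /=; lra.
have [|s sP] := @closed_disc_finite_cover R rho r.
  by move=> z /rP[].
pose bad z := normc z = rho /\ ~ invertible (sc z - a).
exists (undup [seq z <- s | `[<bad z>]]); first exact: undup_uniq.
move=> z; rewrite mem_undup mem_filter; split=> [/andP[/asboolP]//|bz].
apply/andP; split; first exact/asboolP.
have [zr nz] := bz; have [|l [ls lr zl]] := sP z; first by rewrite zr.
have [_ /(_ z zr zl)] := rP l lr.
by have [->//|_ /(_ isT)] := eqVneq z l.
Qed.

(** Isolation and the limit of [(z - l) (z - a)^-1] are what semisimplicity of a
    peripheral point [l] provides, expressed in the ring. *)
Theorem power_bound_semisimple (rho : R) a : 0 < rho ->
  (forall z, rho < normc z -> invertible (sc z - a)) ->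
  (forall l, normc l = rho -> ~ invertible (sc l - a) ->
    (exists2 r, 0 < r &
      forall z, 0 < normc (z - l) < r -> invertible (sc z - a)) /\
    exists P, forall e, 0 < e -> exists2 r, 0 < r & forall z t,
      0 < normc (z - l) < r -> inverse (sc z - a) t ->
      nrm (sc (z - l) * t - P) <= e) ->
  exists C, forall n, nrm (a ^+ n) <= C * rho ^+ n.
Proof.
move=> rho0 inv semi.
have [l lr nl|s us sP] := @isolated_finite rho a.
  by have [] := semi l lr nl.
apply: (@power_bound_deflate rho s) => // [z|l /sP[lr nl]].
  rewrite le_eqVlt => /predU1P[zr|/inv//] zs.
  by apply: contrapT => nz; case/negP: zs; apply/sP.
split=> //; have [iso [P limP]] := semi l lr nl.
exists P; apply: limit_resolvent_projection => //.
apply: contraTneq rho0 => l0.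
by rewrite -lr l0 ComplexField.Normc.normc0 ltxx.
Qed.

End deflation.

(** * Bounded complex-linear operators on the complexification *)

(** Completeness of a normed space in the form that both the Neumann series and
    the Riesz-Fischer theorem use. *)
Definition abs_cvg_complete (R : realType) (E : normedModType R) :=
  forall u : nat -> E, cvgn [normed series u] ->
    exists l : E, series u @ \oo --> l.

Section operator_bounds.
Variables (R : realType) (V W : normedModType R).

Lemma opnormP (f : V -> W) (C : R) :
  (forall r v, f (r *: v) = r *: f v) -> (opnorm f <= C%:E)%E ->
  forall v, `|f v| <= C * `|v|.
Proof.
move=> fZ fC v; have [->|v0] := eqVneq v 0.
  by rewrite -(scale0r 0) fZ !scale0r !normr0 mulr0.
have nv : 0 < `|v| by rewrite normr_gt0.
have : (`|f (`|v|^-1 *: v)|%:E <= C%:E)%E.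
  apply: le_trans fC; apply: ereal_sup_ubound; exists (`|v|^-1 *: v) => //=.
  by rewrite normrZ normfV normr_id mulVf // gt_eqF.
rewrite lee_fin fZ normrZ normfV normr_id => h.
by rewrite -ler_pdivrMr // mulrC.
Qed.

Lemma linear_bound (f : {linear V -> W}) :
  continuous f -> exists2 K, 0 <= K & forall v, `|f v| <= K * `|v|.
Proof.
move=> /linear_bounded_continuous/linear_boundedP[M [Mr fM]].
exists (`|M| + 1) => // v; apply: fM.
by apply: le_lt_trans (ler_norm M) _; rewrite ltrDl.
Qed.

End operator_bounds.

Section cscale_theory.
Variables (R : realType) (E : normedModType R).
Implicit Types (z : R[i]) (u v w : E * E).

Lemma cscaleDr z u v : cscale z (u + v) = cscale z u + cscale z v.
Proof.
rewrite /cscale /= !scalerDr; congr (_, _); last by rewrite addrACA.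
by rewrite opprD addrACA.
Qed.

Lemma cscale0 z : cscale z 0 = 0 :> E * E.
Proof. by apply: (addrI (cscale z 0)); rewrite -cscaleDr !addr0. Qed.

Lemma cscaleN z w : cscale z (- w) = - cscale z w.
Proof. by apply/eqP; rewrite -addr_eq0 -cscaleDr addNr cscale0. Qed.

Lemma cscaleDl z z' w : cscale (z + z') w = cscale z w + cscale z' w.
Proof.
rewrite /cscale !raddfD /= !scalerDl; congr (_, _); last by rewrite addrACA.
by rewrite opprD addrACA.
Qed.

Lemma cscaleM z z' w : cscale (z * z') w = cscale z (cscale z' w).
Proof.
case: z z' w => [a b] [c d] [x y]; rewrite /cscale /=; congr (_, _).
  rewrite !scalerBr !scalerDr !scalerBl !scalerDl !scalerA !opprD.
  by rewrite [LHS]addrACA.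
rewrite !scalerBr !scalerDr !scalerBl !scalerDl !scalerA.
by rewrite [X in X + _ = _]addrC [X in _ + X = _]addrC addrACA.
Qed.

Lemma cscale_real (r : R) w : cscale r%:C%C w = r *: w.
Proof. by case: w => x y; rewrite /cscale /= !scale0r subr0 add0r. Qed.

Lemma cscale1 w : cscale 1 w = w.
Proof. by rewrite -[1]/(1%:C%C) cscale_real scale1r. Qed.

Lemma cscale_norm z w : `|cscale z w| <= 2 * normc z * `|w|.
Proof.
have h1 : `|w.1| <= `|w| by rewrite prod_normE le_max lexx.
have h2 : `|w.2| <= `|w| by rewrite prod_normE le_max lexx orbT.
have a : `|complex.Re z| <= normc z := Re_le_normc z.
have b : `|complex.Im z| <= normc z := Im_le_normc z.
have bound (x y : R) (p q : E) : `|x| <= normc z -> `|y| <= normc z ->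
    `|p| <= `|w| -> `|q| <= `|w| -> `|x *: p| + `|y *: q| <= 2 * normc z * `|w|.
  move=> xz yz pw qw; rewrite !normrZ -mulrA mulr2n mulrDl !mul1r.
  by apply: lerD; apply: ler_pM.
rewrite [leLHS]prod_normE ge_max /=; apply/andP; split.
  by apply: le_trans (ler_normB _ _) _; exact: bound.
by apply: le_trans (ler_normD _ _) _; exact: bound.
Qed.

End cscale_theory.

Section bounded_complex_operators.
Variables (R : realType) (E : normedModType R).

(** The conditions are stated for [cscale], since [E * E] carries only its real
    vector space structure. *)
Record bop := Bop {
  bop_fun :> E * E -> E * E ;
  bop_linear : forall z u v,
    bop_fun (cscale z u + v) = cscale z (bop_fun u) + bop_fun v ;
  bop_bounded : exists2 K, 0 <= K & forall w, `|bop_fun w| <= K * `|w| }.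
Implicit Types (f g h : bop) (w : E * E) (z : R[i]).

Lemma bopP f g : (forall w, f w = g w) -> f = g.
Proof.
case: f g => [f fl fb] [g gl gb] /= fg; have E' : f = g by apply/funext.
by subst g; congr Bop; exact: Prop_irrelevance.
Qed.

Lemma bopD f u v : f (u + v) = f u + f v.
Proof. by have := bop_linear f 1 u v; rewrite !cscale1. Qed.

Lemma bop0 f : f 0 = 0.
Proof. by apply: (addrI (f 0)); rewrite -bopD !addr0. Qed.

Lemma bopZ f z w : f (cscale z w) = cscale z (f w).
Proof. by have := bop_linear f z w 0; rewrite bop0 !addr0. Qed.

Lemma bopN f w : f (- w) = - f w.
Proof. by apply/eqP; rewrite -addr_eq0 -bopD addNr bop0. Qed.

Lemma bopB f u v : f (u - v) = f u - f v.
Proof. by rewrite bopD bopN. Qed.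

HB.instance Definition _ := gen_eqMixin bop.
HB.instance Definition _ := gen_choiceMixin bop.

Lemma add_bop_linear f g z u v : f (cscale z u + v) + g (cscale z u + v) =
  cscale z (f u + g u) + (f v + g v).
Proof. by rewrite !bop_linear cscaleDr addrACA. Qed.

Lemma add_bop_bounded f g :
  exists2 K, 0 <= K & forall w, `|f w + g w| <= K * `|w|.
Proof.
have [K K0 fK] := bop_bounded f; have [L L0 gL] := bop_bounded g.
exists (K + L); first exact: addr_ge0.
by move=> w; apply: le_trans (ler_normD _ _) _; rewrite mulrDl lerD.
Qed.

Definition add_bop f g := Bop (add_bop_linear f g) (add_bop_bounded f g).

Lemma opp_bop_linear f z u v :
  - f (cscale z u + v) = cscale z (- f u) + - f v.
Proof. by rewrite bop_linear opprD cscaleN. Qed.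

Lemma opp_bop_bounded f : exists2 K, 0 <= K & forall w, `|- f w| <= K * `|w|.
Proof.
by have [K K0 fK] := bop_bounded f; exists K => // w; rewrite normrN.
Qed.

Definition opp_bop f := Bop (opp_bop_linear f) (opp_bop_bounded f).

Lemma mul_bop_linear f g z u v :
  f (g (cscale z u + v)) = cscale z (f (g u)) + f (g v).
Proof. by rewrite !bop_linear. Qed.

Lemma mul_bop_bounded f g :
  exists2 K, 0 <= K & forall w, `|f (g w)| <= K * `|w|.
Proof.
have [K K0 fK] := bop_bounded f; have [L L0 gL] := bop_bounded g.
exists (K * L); first exact: mulr_ge0.
by move=> w; apply: le_trans (fK _) _; rewrite -mulrA ler_wpM2l.
Qed.

Definition mul_bop f g := Bop (mul_bop_linear f g) (mul_bop_bounded f g).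

Lemma cscale_linear z z' (u v : E * E) :
  cscale z (cscale z' u + v) = cscale z' (cscale z u) + cscale z v.
Proof. by rewrite cscaleDr -!cscaleM mulrC. Qed.

Lemma cscale_bounded z :
  exists2 K, 0 <= K & forall w : E * E, `|cscale z w| <= K * `|w|.
Proof.
exists (2 * normc z); first by rewrite mulr_ge0 // normc_ge0.
exact: cscale_norm.
Qed.

Definition sc_bop z := Bop (cscale_linear z) (cscale_bounded z).

Lemma zero_bop_linear z (u v : E * E) :
  (0 : E * E) = cscale z 0 + 0.
Proof. by rewrite cscale0 addr0. Qed.

Lemma zero_bop_bounded :
  exists2 K : R, 0 <= K & forall w : E * E, `|0 : E * E| <= K * `|w|.
Proof. by exists 0 => // w; rewrite normr0 mul0r. Qed.

Definition zero_bop := Bop zero_bop_linear zero_bop_bounded.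

Lemma add_bopA : associative add_bop.
Proof. by move=> f g h; apply: bopP => w /=; rewrite addrA. Qed.
Lemma add_bopC : commutative add_bop.
Proof. by move=> f g; apply: bopP => w /=; rewrite addrC. Qed.
Lemma add_0bop : left_id zero_bop add_bop.
Proof. by move=> f; apply: bopP => w /=; rewrite add0r. Qed.
Lemma add_Nbop : left_inverse zero_bop opp_bop add_bop.
Proof. by move=> f; apply: bopP => w /=; rewrite addNr. Qed.

HB.instance Definition _ :=
  GRing.isZmodule.Build bop add_bopA add_bopC add_0bop add_Nbop.

Lemma mul_bopA : associative mul_bop.
Proof. by move=> f g h; apply: bopP. Qed.
Lemma mul_1bop : left_id (sc_bop 1) mul_bop.
Proof. by move=> f; apply: bopP => w /=; rewrite cscale1. Qed.
Lemma mul_bop1 : right_id (sc_bop 1) mul_bop.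
Proof. by move=> f; apply: bopP => w /=; rewrite cscale1. Qed.
Lemma mul_bopDl : left_distributive mul_bop add_bop.
Proof. by move=> f g h; apply: bopP. Qed.
Lemma mul_bopDr : right_distributive mul_bop add_bop.
Proof. by move=> f g h; apply: bopP => w /=; rewrite bopD. Qed.

HB.instance Definition _ := GRing.Zmodule_isPzRing.Build bop
  mul_bopA mul_1bop mul_bop1 mul_bopDl mul_bopDr.

Lemma sc_bop_additive : zmod_morphism sc_bop.
Proof.
move=> z z'; apply: bopP => w.
rewrite -[LHS]/(cscale (z - z') w) -[RHS]/(cscale z w - cscale z' w).
by apply: (addIr (cscale z' w)); rewrite -cscaleDl !subrK.
Qed.

Lemma sc_bop_multiplicative : monoid_morphism sc_bop.
Proof. by split=> // z z'; apply: bopP => w /=; rewrite cscaleM. Qed.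

HB.instance Definition _ :=
  GRing.isZmodMorphism.Build R[i] bop sc_bop sc_bop_additive.
HB.instance Definition _ :=
  GRing.isMonoidMorphism.Build R[i] bop sc_bop sc_bop_multiplicative.

Definition bop_norm f : R :=
  inf [set K | 0 <= K /\ forall w, `|f w| <= K * `|w|].

Lemma bop_norm_has_inf f :
  has_inf [set K | 0 <= K /\ forall w, `|f w| <= K * `|w|].
Proof.
split; last by exists 0 => K [].
by have [K K0 fK] := bop_bounded f; exists K.
Qed.

Lemma bop_norm_le f K : 0 <= K -> (forall w, `|f w| <= K * `|w|) ->
  bop_norm f <= K.
Proof. by move=> K0 fK; apply: ge_inf => //; exact: (bop_norm_has_inf f).2. Qed.

Lemma bop_norm_ge0 f : 0 <= bop_norm f.
Proof. by apply: lb_le_inf; [exact: (bop_norm_has_inf f).1|move=> K []]. Qed.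

Lemma bop_normP f w : `|f w| <= bop_norm f * `|w|.
Proof.
have [->|w0] := eqVneq w 0; first by rewrite bop0 !normr0 mulr0.
have nw : 0 < `|w| by rewrite normr_gt0.
rewrite -ler_pdivrMr //; apply: lb_le_inf; first exact: (bop_norm_has_inf f).1.
by move=> K [_ fK]; rewrite ler_pdivrMr.
Qed.

Lemma abs_cvg_complete_prod : abs_cvg_complete E ->
  abs_cvg_complete (E * E)%type.
Proof.
move=> cE u cu.
have sub (p : E * E -> E) : (forall w, `|p w| <= `|w|) ->
    exists l : E, series (p \o u) @ \oo --> l.
  move=> pw; apply: cE; apply: series_le_cvg cu => //= n; exact: normr_ge0.
have [|l1 ul1] := sub fst; first by move=> w; rewrite prod_normE le_max lexx.
have [|l2 ul2] := sub snd.
  by move=> w; rewrite prod_normE le_max lexx orbT.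
exists (l1, l2).
rewrite (_ : series u = fun n => (series (fst \o u) n, series (snd \o u) n)).
  exact: cvg_pair.
apply/funext => n; rewrite /series /=.
rewrite [LHS]surjective_pairing; congr (_, _).
  exact: (big_morph fst (fun _ _ => erefl) erefl).
exact: (big_morph snd (fun _ _ => erefl) erefl).
Qed.

(** [x = \sum_k f^k w] solves [x - f x = w].  The inverse is assembled
    pointwise, and uniqueness of the solution makes it linear. *)
Lemma bop_neumann : abs_cvg_complete E -> forall f, bop_norm f <= 1 / 2 ->
  invertible (1 - f).
Proof.
move=> /abs_cvg_complete_prod cE f f2.
have fw w : `|f w| <= 1 / 2 * `|w|.
  by apply: le_trans (bop_normP f w) _; rewrite ler_wpM2r.
have ex w : exists x, x - f x = w.
  pose u n := (f ^+ n) w.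
  have uS n : u n.+1 = f (u n) by rewrite /u exprS.
  have u_le n : `|u n| <= `|w| * (1 / 2) ^+ n.
    elim: n => [|n ih]; first by rewrite /u expr0 /= cscale1 mulr1.
    rewrite uS; apply: le_trans (fw _) _; rewrite exprS mulrCA.
    by rewrite ler_pM2l.
  have cu : cvgn [normed series u].
    have h : `|1 / 2 : R| < 1 by rewrite ger0_norm; lra.
    have gc := @is_cvg_geometric_series _ `|w| _ h.
    apply: series_le_cvg gc => // n; first exact: normr_ge0.
    by rewrite /geometric /= mulr_ge0 // exprn_ge0 // divr_ge0.
  have [x xP] := cE u cu.
  exists x; apply/eqP; rewrite -subr_eq0 -normr_le0.
  apply/ler_addgt0Pl => e e0; rewrite addr0.
  have e2 : 0 < e / 2 by rewrite divr_gt0.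
  have [N _ NP] := (@cvgrPdist_lt _ _ _ _ _ _ _).1 xP _ e2.
  have h1 := NP N (leqnn _); have h2 := NP N.+1 (leqnSn _).
  have sS : series u N.+1 = w + f (series u N).
    have fs n : f (series u n) = \sum_(0 <= k < n) u k.+1.
      elim: n => [|n ih]; first by rewrite /series /= !big_geq // bop0.
      by rewrite /series /= !big_nat_recr //= bopD -uS; congr (_ + _).
    rewrite fs /series /= big_nat_recl //; congr (_ + _).
    by rewrite /u expr0 /= cscale1.
  have -> : x - f x - w = (x - series u N.+1) - f (x - series u N).
    by rewrite sS bopB !opprB opprD !addrA subrK addrAC.
  apply: le_trans (ler_normB _ _) _; have := fw (x - series u N).
  by move=> h3; rewrite /= in h1 h2; lra.
have inj x : x - f x = 0 -> x = 0.
  move=> /subr0_eq xE; apply/eqP; rewrite -normr_le0.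
  by have := fw x; rewrite -xE; have := normr_ge0 x; lra.
have [g gP] := choice ex.
have uniq x y : x - f x = y - f y -> x = y.
  move=> xy; apply/subr0_eq/inj; rewrite bopB.
  by rewrite opprD addrACA -opprD xy subrr.
have gl z u v : g (cscale z u + v) = cscale z (g u) + g v.
  apply: uniq; rewrite gP bop_linear opprD addrACA gP.
  by rewrite -cscaleN -cscaleDr gP.
have gb : exists2 K, 0 <= K & forall w, `|g w| <= K * `|w|.
  exists 2 => // w; have := fw (g w).
  have := ler_normD (g w - f (g w)) (f (g w)).
  by rewrite subrK gP; lra.
exists (Bop gl gb); split; apply: bopP => w /=; rewrite !cscale1.
  exact: gP.
by apply: uniq; rewrite gP.
Qed.

Lemma bop_banach_norm : abs_cvg_complete E ->
  complex_banach_norm sc_bop bop_norm.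
Proof.
move=> cE; split.
- by move=> z f; apply: bopP => w /=; rewrite bopZ.
- exact: bop_norm_ge0.
- move=> f f0; apply: bopP => w; apply/eqP; rewrite -normr_le0.
  by have := bop_normP f w; rewrite f0 mul0r.
- by apply: bop_norm_le => // w; rewrite /= cscale1 mul1r.
- move=> f; apply/eqP; rewrite eq_le; apply/andP; split.
    apply: bop_norm_le => [|w]; first exact: bop_norm_ge0.
    by rewrite /= normrN; exact: bop_normP.
  apply: bop_norm_le => [|w]; first exact: bop_norm_ge0.
  by rewrite -normrN; exact: (bop_normP (- f)).
- move=> f g; apply: bop_norm_le => [|w].
    by rewrite addr_ge0 ?bop_norm_ge0.
  by apply: le_trans (ler_normD _ _) _; rewrite mulrDl lerD ?bop_normP.
- move=> f g; apply: bop_norm_le => [|w].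
    by rewrite mulr_ge0 ?bop_norm_ge0.
  apply: le_trans (bop_normP f (g w)) _; rewrite -mulrA.
  by rewrite ler_wpM2l ?bop_norm_ge0 ?bop_normP.
- move=> z f; apply: bop_norm_le => [|w].
    by rewrite mulr_ge0 ?bop_norm_ge0 // mulr_ge0 ?normc_ge0.
  apply: le_trans (cscale_norm z (f w)) _; rewrite -[leRHS]mulrA.
  by rewrite ler_wpM2l ?bop_normP // mulr_ge0 ?normc_ge0.
- exact: bop_neumann.
Qed.

End bounded_complex_operators.

(** * Spectra of operators on real Banach spaces *)

Section resolvent_bop.
Variables (R : realType) (E : normedModType R) (S : {linear E -> E}).
Variables (K : R) (SK : forall x, `|S x| <= K * `|x|).
Implicit Types (z l : R[i]) (w : E * E).

Lemma complexify_linear z u v :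
  complexify S (cscale z u + v) = cscale z (complexify S u) + complexify S v.
Proof.
by rewrite /complexify /cscale /= !linearD linearN !linearZ.
Qed.

Lemma complexify_bounded :
  exists2 L, 0 <= L & forall w, `|complexify S w| <= L * `|w|.
Proof.
exists `|K| => // w; rewrite !prod_normE /= ge_max.
have KS x : `|S x| <= `|K| * `|x|.
  by apply: le_trans (SK x) _; rewrite ler_wpM2r ?ler_norm.
apply/andP; split; apply: le_trans (KS _) _; rewrite ler_wpM2l //.
  by rewrite le_max lexx.
by rewrite le_max lexx orbT.
Qed.

Definition complexify_bop : bop E := Bop complexify_linear complexify_bounded.
Local Notation A := complexify_bop.

Lemma bop_real_linear (t : bop E) : linear t.
Proof. by move=> r u v; rewrite -!cscale_real (bop_linear t). Qed.

Lemma resolvent_of_inverse z (t : bop E) : inverse (sc_bop E z - A) t ->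
  exists T : {linear (E * E)%type -> (E * E)%type},
    is_resolvent S z T /\ T =1 t.
Proof.
move=> [zt tz].
pose T : {linear (E * E)%type -> (E * E)%type} := HB.pack (bop_fun t)
  (GRing.isLinear.Build R (E * E)%type (E * E)%type *:%R t (bop_real_linear t)).
exists T; split=> //; split.
- apply: bounded_linear_continuous; apply/linear_boundedP.
  have [L L0 tL] := bop_bounded t; exists L; split; first exact: ger0_real.
  move=> M LM w; apply: le_trans (tL w) _.
  by rewrite ler_wpM2r // ltW.
- move=> w; have := congr1 (fun f : bop E => f w) zt.
  by rewrite /= cscale1.
- move=> w; have := congr1 (fun f : bop E => f w) tz.
  by rewrite /= cscale1.
Qed.

(** A resolvent is only given as a real-linear map; it is complex-linear because
    it inverts a complex-linear one. *)
Lemma inverse_of_resolvent z (T : {linear (E * E)%type -> (E * E)%type}) :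
  is_resolvent S z T -> exists t : bop E, inverse (sc_bop E z - A) t /\ T =1 t.
Proof.
move=> [cT TK KT].
have Tl c u v : T (cscale c u + v) = cscale c (T u) + T v.
  rewrite -[RHS]KT; congr (T _); rewrite complexify_linear cscaleDr.
  rewrite opprD addrACA; congr (_ + _); last by rewrite TK.
  by rewrite -cscaleM mulrC cscaleM -cscaleN -cscaleDr TK.
have Tb := linear_bound cT.
exists (Bop Tl Tb); split=> //; split; apply: bopP => w /=; rewrite cscale1.
  exact: TK.
exact: KT.
Qed.

Lemma spectrumP z : spectrum S z <-> ~ invertible (sc_bop E z - A).
Proof.
split; apply: contra_not.
  by move=> [t /resolvent_of_inverse[T [rT _]]]; exists T.
by move=> [T /inverse_of_resolvent[t [it _]]]; exists t.
Qed.

(** The residue [P] is only given as a real-linear map; it is complex-linear as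
    a limit of the complex-linear operators [(z - l) (z - a)^-1], and isolation
    of [l] provides such operators for [z] arbitrarily close to [l]. *)
Lemma pole_projection l : isolated_in_spectrum S l -> first_order_pole S l ->
  exists P : bop E, forall e, 0 < e -> exists2 r, 0 < r & forall z t,
    0 < normc (z - l) < r -> inverse (sc_bop E z - A) t ->
    bop_norm (sc_bop E (z - l) * t - P) <= e.
Proof.
move=> [_ [r0 r00 iso]] [P [cP _ limP]].
have bound e z (T : {linear (E * E)%type -> (E * E)%type}) :
    (opnorm (fun w => (cscale (z - l) (T w) - P w)%R) <= e%:E)%E ->
    forall w, `|cscale (z - l) (T w) - P w| <= e * `|w|.
  apply: opnormP => r w; rewrite !linearZ /= scalerDr scalerN.
  by congr (_ - _); rewrite -!cscale_real -!cscaleM mulrC.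
have Pl c u v : P (cscale c u + v) = cscale c (P u) + P v.
  rewrite linearD; congr (_ + _); apply/eqP; rewrite -subr_eq0 -normr_le0.
  apply/ler_addgt0Pl => e e0; rewrite addr0.
  (* If (z - l) T differs from P by at most e / k in norm, then moving the
     scalar c through P costs at most (e / k) k. *)
  pose k := `|cscale c u| + 2 * normc c * `|u| + 1.
  have c0 : 0 <= 2 * normc c * `|u| by rewrite mulr_ge0 // mulr_ge0 ?normc_ge0.
  have k0 : 0 < k by rewrite ltr_wpDl // addr_ge0.
  have [r r1 rP] := limP (e / k) (divr_gt0 e0 k0).
  pose d := Num.min r0 r / 2.
  have m0 : 0 < Num.min r0 r by rewrite lt_min r00.
  have d0 : 0 < d by rewrite divr_gt0.
  have : d < Num.min r0 r by rewrite /d; lra.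
  rewrite lt_min => /andP[dr0 dr].
  pose z := l + d%:C%C.
  have zl : normc (z - l) = d.
    by rewrite /z [l + _]addrC addrK normc_real ger0_norm ?ltW.
  have : ~ spectrum S z by apply: iso; rewrite zl d0.
  move=> /contrapT[T rT]; have [t [it Tt]] := inverse_of_resolvent rT.
  have zT : 0 < normc (z - l) < r by rewrite zl d0.
  have h := bound _ _ _ (rP z T zT rT).
  have h1 := h (cscale c u); have h2 := h u.
  have E1 : cscale (z - l) (T (cscale c u)) = cscale c (cscale (z - l) (T u)).
    by rewrite !Tt bopZ -!cscaleM mulrC.
  rewrite E1 in h1.
  have -> : P (cscale c u) - cscale c (P u) =
      cscale c (cscale (z - l) (T u) - P u) -
      (cscale c (cscale (z - l) (T u)) - P (cscale c u)).
    rewrite cscaleDr cscaleN.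
    by rewrite opprB [RHS]addrC addrA subrK.
  apply: le_trans (ler_normB _ _) _.
  have h3 := cscale_norm c (cscale (z - l) (T u) - P u).
  have h4 : 2 * normc c * `|cscale (z - l) (T u) - P u| <=
      2 * normc c * (e / k * `|u|).
    by rewrite ler_wpM2l // mulr_ge0 ?normc_ge0.
  have h5 : e / k * k = e by rewrite divfK // gt_eqF.
  have q0 : 0 < e / k by exact: divr_gt0.
  rewrite -[leRHS]h5; move: (e / k) q0 h1 h2 h3 h4 {h h5} => q q0 h1 h2 h3 h4.
  rewrite /k; lra.
exists (Bop Pl (linear_bound cP)) => e e0; have [r r1 rP] := limP e e0.
exists r => // z t zr it; have [T [rT Tt]] := resolvent_of_inverse it.
apply: bop_norm_le => [|w]; first exact: ltW.
have := bound _ _ _ (rP z T zr rT) w; rewrite Tt.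
by [].
Qed.

End resolvent_bop.

(** The supremum of an unbounded set is [0] by convention, so positivity of the
    spectral radius makes the spectrum bounded. *)
Lemma spectral_radius_ub (R : realType) (E : normedModType R) (S : E -> E) z :
  0 < spectral_radius S -> spectrum S z -> normc z <= spectral_radius S.
Proof.
move=> r0 sz; apply: ub_le_sup; last by exists z.
have [[]//|h] := pselect (has_sup [set normc z | z in spectrum S]).
by move: r0; rewrite /spectral_radius (sup_out h) ltxx.
Qed.

Theorem power_bound_spectral_radius (R : realType) (E : normedModType R)
  (S : {linear E -> E}) (K : R) : abs_cvg_complete E ->
  (forall x, `|S x| <= K * `|x|) -> 0 < spectral_radius S ->
  (forall l, spectrum S l -> normc l = spectral_radius S -> semisimple S l) ->
  exists2 C : R, 0 < C & forall N : nat,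
    (opnorm (iter N S) <= (C * spectral_radius S ^+ N)%:E)%E.
Proof.
move=> cE SK rho0 semi; set rho := spectral_radius S.
pose A := complexify_bop SK.
have [||C AC] :=
  @power_bound_semisimple _ _ _ _ (bop_banach_norm cE) rho A rho0.
- move=> z rz; apply: contrapT => /(spectrumP SK) /(spectral_radius_ub rho0).
  by rewrite leNgt rz.
- move=> l lr /(spectrumP SK) sl; have [iso pole] := semi l sl lr.
  split; last exact: pole_projection.
  have [_ [r r0 rP]] := iso; exists r => // z /rP nz.
  by apply: contrapT => /(spectrumP SK).
exists (`|C| + 1) => [|N]; first by rewrite ltr_wpDl.
apply: ge_ereal_sup => _ [x /= x1 <-]; rewrite lee_fin.
have SN : ((A ^+ N) (x, 0)).1 = iter N S x.
  elim: N => [|N ih].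
    by rewrite expr0; exact: (congr1 fst (cscale1 (x, 0))).
  by rewrite exprS iterS -ih.
have rN : 0 < rho ^+ N by rewrite exprn_gt0.
rewrite -SN; apply: le_trans (_ : `|(A ^+ N) (x, 0)| <= _).
  by rewrite prod_normE le_max lexx.
apply: le_trans (bop_normP _ _) _.
have nx : `|(x, 0) : E * E| <= 1 by rewrite prod_normE /= normr0 max_l.
have := AC N; have := bop_norm_ge0 (A ^+ N).
have : C * rho ^+ N <= `|C| * rho ^+ N by rewrite ler_wpM2r ?ler_norm ?ltW.
have : bop_norm (A ^+ N) * `|(x, 0) : E * E| <= bop_norm (A ^+ N).
  by rewrite ler_piMr // bop_norm_ge0.
lra.
Qed.

(** * Completeness of L^p and of its subspace of mean zero *)

Section riesz_fischer.
Context d (T : measurableType d) (R : realType) (mu : probability T R).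

Local Notation "''N_' p [ f ]" := (Lnorm mu p%:E (EFin \o f)).

Lemma measurable_norm_powR (p : R) (h : T -> R) : measurable_fun setT h ->
  measurable_fun setT (fun x => `|h x| `^ p).
Proof.
move=> mh; apply: (@measurableT_comp _ _ _ _ _ _ (@powR R ^~ p)) => //.
exact: measurableT_comp.
Qed.

Lemma Lnorm_integral (p : R) (h : T -> R) : p != 0 ->
  ('N_p[h] `^ p)%E = (\int[mu]_x (`|h x| `^ p)%:E)%E.
Proof. by move=> p0; rewrite powR_Lnorm. Qed.

(** Hoelder's inequality against the constant [1] of a probability space. *)
Lemma Lnorm1_le (p : R) (h : T -> R) : 1 <= p -> measurable_fun setT h ->
  ('N_1[h] <= 'N_p[h])%E.
Proof.
rewrite le_eqVlt => /predU1P[<-//|p1] mh.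
have p0 : 0 < p by exact: lt_trans p1.
have pV : p^-1 < 1 by rewrite invf_lt1.
have := @hoelder _ _ _ mu h (cst 1) p (1 - p^-1)^-1 mh (measurable_cst _) p0.
rewrite invrK invr_gt0 subr_gt0 pV subrKC => /(_ isT erefl).
rewrite Lnorm_cst1 [X in (X `^ _)%E](@probability_setT _ _ _ mu).
rewrite poweR1r mule1; apply: le_trans.
by rewrite le_eqVlt; apply/orP; left; apply/eqP/eq_Lnorm => x /=; rewrite mulr1.
Qed.

Lemma powR_continuous (p a : R) : 0 < a ->
  {for a, continuous (fun x : R => x `^ p)}.
Proof.
move=> a0; apply: differentiable_continuous; apply/derivable1_diffP.
by apply: derivable_powR; rewrite in_itv /= a0.
Qed.

Lemma limn_einf_le (u : nat -> \bar R) (c : \bar R) :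
  (forall n, u n <= c)%E -> (limn_einf u <= c)%E.
Proof.
move=> uc; rewrite limn_einf_lim; apply: lime_le; first exact: is_cvg_einfs.
apply: nearW => n; apply: le_trans (uc n); apply: ereal_inf_lbound.
by exists n => /=.
Qed.

(** Fatou's lemma for the powers [`|h_ n x| `^ p]. *)
Lemma Lnorm_fatou (p : R) (h_ : nat -> T -> R) (h : T -> R) (C : R) : 1 <= p ->
  (forall n, measurable_fun setT (h_ n)) -> measurable_fun setT h ->
  {ae mu, forall x, h_ ^~ x @ \oo --> h x} ->
  (forall n, 'N_p[h_ n] <= C%:E)%E -> ('N_p[h] <= C%:E)%E.
Proof.
move=> p1 mh_ mh cv hC.
have p0 : 0 < p by exact: lt_le_trans p1.
have C0 : 0 <= C.
  by have := hC 0; rewrite -lee_fin; apply: le_trans; exact: Lnorm_ge0.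
suff : ('N_p[h] `^ p <= C%:E `^ p)%E.
  move=> /(@gt0_ler_poweR _ p^-1); rewrite -!poweRrM mulfV ?gt_eqF //.
  rewrite !poweRe1 ?lee_fin ?Lnorm_ge0 //; apply.
  - by rewrite invr_ge0 ltW.
  - by rewrite in_itv; apply/andP; split; [exact: poweR_ge0|exact: leey].
  - by rewrite in_itv; apply/andP; split; [exact: poweR_ge0|exact: leey].
have mp n : measurable_fun setT (fun x => (`|h_ n x| `^ p)%:E).
  by apply/measurable_EFinP; exact: measurable_norm_powR.
rewrite Lnorm_integral ?gt_eqF //.
apply: le_trans
  (_ : \int[mu]_x limn_einf (fun n => (`|h_ n x| `^ p)%:E) <= _)%E.
  apply: ae_ge0_le_integral => //.
  - by apply/measurable_EFinP; exact: measurable_norm_powR.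
  - move=> x _; rewrite limn_einf_lim.
    apply: lime_ge; first exact: is_cvg_einfs.
    apply: nearW => n; apply: le_ereal_inf_tmp => _ [k _ <-].
    by rewrite lee_fin powR_ge0.
  - rewrite (_ : (fun x => limn_einf _) =
      fun x => (- limn_esup (fun n => - (`|h_ n x| `^ p)%:E))%E) //.
    apply: measurableT_comp => //; apply: measurable_fun_limn_esup => n.
    by apply: measurableT_comp.
  apply: filterS cv => x hx _.
  (* The power function is differentiable, hence continuous, only away from 0;
     at 0 nonnegativity is enough. *)
  have [h0|h0] := eqVneq (h x) 0.
    rewrite h0 normr0 powR0 ?gt_eqF //.
    rewrite limn_einf_lim; apply: lime_ge; first exact: is_cvg_einfs.
    apply: nearW => n; apply: le_ereal_inf_tmp => _ [k _ <-].
    by rewrite lee_fin powR_ge0.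
  have cvp : (fun n => (`|h_ n x| `^ p)%:E) @ \oo --> (`|h x| `^ p)%:E.
    apply: cvg_EFin; first exact: nearW.
    apply: (@continuous_cvg _ R R \oo _ (fun n => `|h_ n x|)
      (fun y : R => y `^ p)); last exact: cvg_norm.
    by apply: powR_continuous; rewrite normr_gt0.
  rewrite is_cvg_limn_einfE; last by apply/cvg_ex; eexists; exact: cvp.
  by rewrite (cvg_lim _ cvp).
apply: le_trans (fatou mu measurableT mp _) _.
  by move=> n x _; rewrite lee_fin powR_ge0.
apply: limn_einf_le => n; rewrite -Lnorm_integral ?gt_eqF //.
by apply: gt0_ler_poweR;
  rewrite ?in_itv /= ?Lnorm_ge0 ?leey ?lee_fin ?C0 // ltW.
Qed.

Variables (p : R) (p1 : (1 <= p%:E)%E).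
Local Notation Lp := (Lp mu p1).

Lemma Lp_norm_Lnorm (f : Lp) : (`|f|%:E = 'N_p[f])%E.
Proof. exact: Lp_normE. Qed.

Lemma Lp_fun0 : (0 : Lp) = cst 0 %[ae mu].
Proof.
have := Lp_funZ 0 (0 : Lp); rewrite scale0r; apply: filterS => x h _.
by rewrite (h I) /= scale0r.
Qed.

Lemma Lp_funB (f g : Lp) : (f - g : Lp) = f \- g %[ae mu].
Proof.
rewrite -scaleN1r; apply: filterS2 (Lp_funD f (-1 *: g)) (Lp_funZ (-1) g).
by move=> x h1 h2 _; rewrite (h1 I) /= (h2 I) /= scaleN1r.
Qed.

Lemma Lp_fun_series (u : nat -> Lp) n :
  (series u n : Lp) = (fun x => series (fun k => u k x) n) %[ae mu].
Proof.
elim: n => [|n ih].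
  rewrite /series /= big_geq //; apply: filterS Lp_fun0 => x h _.
  by rewrite (h I) big_geq.
rewrite /series /= big_nat_recr //=.
apply: filterS2 (Lp_funD (\sum_(0 <= k < n) u k) (u n)) ih => x h1 h2 _.
by rewrite (h1 I) /= big_nat_recr //=; congr (_ + _); exact: (h2 I).
Qed.

Let p1' : 1 <= p. Proof. by rewrite -lee_fin. Qed.

(** The L^1 norms are bounded by the L^p norms, so the function
    [\sum_n |u n|] is integrable, hence finite almost everywhere. *)
Lemma Lp_series_ae_cvg (u : nat -> Lp) : cvgn [normed series u] ->
  {ae mu, forall x, cvgn (series (fun n => u n x))}.
Proof.
move=> cu; pose a n x := (`|u n x|%:E)%E.
have ma n : measurable_fun setT (a n).
  have mu_n := Lp_fun_measurable (u n).
  by apply/measurable_EFinP; exact: measurableT_comp.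
pose g x := (\sum_(0 <= n <oo) a n x)%E.
have g0 x : (0 <= g x)%E by apply: nneseries_ge0 => n _ _; rewrite lee_fin.
have mg : measurable_fun setT g.
  by apply: ge0_emeasurable_sum => // n x _ _; rewrite lee_fin.
have gfin : (\int[mu]_x g x < +oo)%E.
  rewrite integral_nneseries //; last by move=> n x _; rewrite lee_fin.
  apply: le_lt_trans (ltry (limn [normed series u])).
  apply: le_trans (_ : \sum_(0 <= n <oo) (`|u n|%:E) <= _)%E.
    apply: lee_nneseries => [n _ _|n _].
      by apply: integral_ge0 => x _; rewrite lee_fin.
    rewrite Lp_norm_Lnorm.
    apply: le_trans (Lnorm1_le p1' (Lp_fun_measurable _)).
    by rewrite Lnorm1.
  apply: lime_le; first by apply: is_cvg_nneseries => n _ _; rewrite lee_fin.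
  apply: nearW => n; rewrite sumEFin lee_fin.
  apply: (nondecreasing_cvgn_le _ cu).
  by apply: nondecreasing_series => k _ _; exact: normr_ge0.
have ig : mu.-integrable setT g.
  apply/integrableP; split=> //.
  by under eq_integral do rewrite gee0_abs //.
apply: filterS (integrable_ae measurableT ig) => x /(_ I) gx.
apply: normed_cvg; apply: nondecreasing_is_cvgn.
  by apply: nondecreasing_series => k _ _; exact: normr_ge0.
exists (fine (g x)) => _ [n _ <-]; rewrite -lee_fin fineK //.
rewrite /= -sumEFin.
by apply: (nneseries_lim_ge n) => k _ _; rewrite lee_fin.
Qed.

(** Riesz-Fischer: the series converges almost everywhere to a function [f], and
    lower semicontinuity of the norm bounds [f - s n] by the tail of the series
    of norms. *)
Theorem Lp_complete (u : nat -> Lp) : cvgn [normed series u] ->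
  exists l : Lp, series u @ \oo --> l.
Proof.
move=> cu; set M := limn [normed series u].
pose s n x := series (fun k => u k x) n.
have ms n : measurable_fun setT (s n).
  by apply: measurable_sum => k; exact: Lp_fun_measurable.
(* The upper limit is measurable, and it is the sum wherever the series
   converges. *)
pose f x := fine (limn_esup (fun n => (s n x)%:E)).
have mf : measurable_fun setT f.
  apply: measurableT_comp => //.
  by apply: measurable_fun_limn_esup => n; apply/measurable_EFinP.
have sf : {ae mu, forall x, s ^~ x @ \oo --> f x}.
  apply: filterS (Lp_series_ae_cvg cu) => x cx.
  have ce : (fun n => (s n x)%:E) @ \oo --> (limn (s ^~ x))%:E.
    by apply: cvg_EFin; [exact: nearW|exact: cx].
  rewrite /f is_cvg_limn_esupE; last by apply/cvg_ex; eexists; exact: ce.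
  by rewrite (cvg_lim _ ce).
have norm_le n : [normed series u] n <= M.
  apply: (nondecreasing_cvgn_le _ cu).
  by apply: nondecreasing_series => k _ _; exact: normr_ge0.
pose tail n := M - [normed series u] n.
have fs n : ('N_p[(fun x => (f x - s n x)%R)] <= (tail n)%:E)%E.
  apply: (@Lnorm_fatou p (fun m x => s (n + m)%N x - s n x)) => //.
  - by move=> m; apply: measurable_funB.
  - exact: measurable_funB.
  - apply: filterS sf => x sx; apply: cvgB; last exact: cvg_cst.
    rewrite (_ : (fun m => s (n + m)%N x) = (fun m => s (m + n)%N x)).
      by rewrite (cvg_shiftn n (s ^~ x)).
    by apply/funext => m; rewrite addnC.
  - move=> m.
    rewrite (@eq_ae_Lnorm _ _ _ mu p _ (series u (n + m) - series u n : Lp)).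
    + rewrite -Lp_norm_Lnorm lee_fin /tail lerBrDr.
      apply: le_trans (norm_le (n + m)%N).
      rewrite sub_series_geq ?leq_addr // -lerBrDr.
      rewrite sub_series_geq ?leq_addr //.
      exact: ler_norm_sum.
    + exact: measurable_funB.
    + exact: Lp_fun_measurable.
    + apply: filterS3 (Lp_funB (series u (n + m)%N) (series u n))
        (Lp_fun_series u (n + m)%N) (Lp_fun_series u n) => x h1 h2 h3 _.
      by rewrite (h1 I) /= (h2 I) (h3 I).
have fL : f \in Lfun mu p%:E.
  rewrite inE; apply/andP; split; rewrite inE //=.
  have := fs 0; rewrite /finite_norm => /le_lt_trans; move/(_ _ (ltry _)).
  congr (Lnorm _ _ _ < _)%E; apply/funext => x /=.
  by rewrite /s /series /= big_geq // subr0.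
pose F : Lp := Lp_class (Lfun_Sub p1 fL).
have FE : F = f %[ae mu] by exact: Lp_class_fun.
have Fs n : `|F - series u n| <= tail n.
  rewrite -lee_fin Lp_norm_Lnorm; apply: le_trans (fs n).
  rewrite le_eqVlt; apply/orP; left; apply/eqP/eq_ae_Lnorm => //.
  - exact: measurable_funB.
  - apply: filterS3 (Lp_funB F (series u n)) FE (Lp_fun_series u n).
    by move=> x h1 h2 h3 _; rewrite (h1 I) /= (h2 I) (h3 I).
exists F; apply/cvgrPdist_le => e e0.
have [N _ small] := (@cvgrPdist_le _ _ _ _ _ _ _).1 cu _ e0.
exists N => // n /small h; apply: le_trans (Fs n) _.
by apply: le_trans h; exact: ler_norm.
Qed.

Lemma Lp_mean_bound (f : Lp) : `|Lp_mean f| <= `|f|.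
Proof.
rewrite -lee_fin Lp_norm_Lnorm.
apply: le_trans (Lnorm1_le p1' (Lp_fun_measurable f)).
rewrite Lnorm1 /Lp_mean /Rintegral -abse_EFin.
have If := Lp_integrable f.
rewrite fineK; last exact: integrable_fin_num.
apply: le_abse_integral => //.
by apply/measurable_EFinP; exact: Lp_fun_measurable.
Qed.

(** Functions of mean zero form a closed subspace, as the mean is bounded by the
    norm. *)
Theorem ImPi_complete : abs_cvg_complete (ImPi mu p1).
Proof.
move=> u cu.
have [F uF] := @Lp_complete (fun n => ImPi_val (u n)) cu.
have valE n : series (fun n => ImPi_val (u n)) n = ImPi_val (series u n).
  rewrite /series /=; symmetry.
  exact: (big_morph (@ImPi_val _ _ _ mu p p1) (fun _ _ => erefl) erefl).
have F0 : F \in @ImPi_pred _ _ _ mu p p1.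
  rewrite ImPi_predE -normr_le0; apply/ler_addgt0Pl => e e0; rewrite addr0.
  have [N _ NP] := (@cvgrPdist_le _ _ _ _ _ _ _).1 uF _ e0.
  have := NP N (leqnn _); rewrite valE => h; apply: le_trans h.
  apply: le_trans (Lp_mean_bound _); rewrite addrC -scaleN1r Lp_mean_linear.
  have : ImPi_val (series u N) \in @ImPi_pred _ _ _ mu p p1.
    by case: (series u N).
  by rewrite ImPi_predE => /eqP ->; rewrite mulr0 add0r.
pose G : ImPi mu p1 := Build_ImPi F0.
exists G; apply/cvgrPdist_le => e e0.
have [N _ small] := (@cvgrPdist_le _ _ _ _ _ _ _).1 uF _ e0.
by exists N => // n /small /=; rewrite valE.
Qed.

End riesz_fischer.

(** * Periodicity of the invariant measures *)

Section translation.
Variable R : realType.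
Local Notation mu := (@lebesgue_measure R).

Let shift (c : R) : measurableTypeR R -> measurableTypeR R :=
  fun x : R => x + c.

Let measurable_shift (c : R) : measurable_fun setT (shift c).
Proof.
have h : measurable_fun [set: R] (fun x => x + c) by apply: measurable_funD.
exact: h.
Qed.

(** The translated measure agrees with Lebesgue measure on half-open intervals,
    which determine it. *)
Lemma lebesgue_measure_translate (c : R) (A : set R) : measurable A ->
  mu A = mu ((fun x => x + c) @^-1` A).
Proof.
move=> mA; pose nu : {measure set (measurableTypeR R) -> \bar R} :=
  measure_function_pushforward__canonical__measure_function_Measure
    mu (measurable_shift c).
rewrite -[RHS]/(nu A).
apply: lebesgue_measure_unique mA => _ [[a b] _ <-].
rewrite -[RHS]/(mu ((fun x => x + c) @^-1` `]a, b]%classic)).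
rewrite (_ : _ @^-1` _ = `]a - c, b - c]%classic).
  rewrite !lebesgue_measure_itv /= !lte_fin ltrD2r.
  by case: ifP => // _; rewrite -!EFinB opprB addrA subrK.
by apply/seteqP; split=> x; rewrite /= !in_itv /= ltrBlDr lerBrDr.
Qed.

Lemma ge0_integral_translate (c : R) (D : set R) (f : R -> \bar R) :
  measurable D -> measurable_fun D f -> (forall x, D x -> 0 <= f x)%E ->
  (\int[mu]_(x in D) f x =
   \int[mu]_(x in (fun x => x + c)%R @^-1` D) f (x + c)%R)%E.
Proof.
move=> mD mf f0.
have := ge0_integral_pushforward (measurable_shift c) mu mD mf.
move=> <-; last by move=> x /set_mem/f0.
apply: eq_measure_integral => A mA AD.
exact: lebesgue_measure_translate.
Qed.

Lemma integrable_translate (c : R) (D : set R) (f : R -> \bar R) :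
  measurable D -> mu.-integrable D f ->
  let D' := (fun x => x + c) @^-1` D in let f' x := f (x + c) in
  mu.-integrable D' f' /\
  (\int[mu]_(x in D) f x = \int[mu]_(x in D') f' x)%E.
Proof.
move=> mD If /=; have mf := measurable_int _ If.
have mphi : measurable_fun setT (fun x : R => x + c).
  by apply: measurable_funD.
have mD' : measurable ((fun x => x + c) @^-1` D).
  by rewrite -[X in measurable X]setTI; exact: mphi.
split.
  apply/integrableP; split.
    apply: (@measurable_comp _ _ _ _ _ _ D) => //; last exact: measurable_funTS.
    by move=> _ [x Dx <-].
  rewrite -(@ge0_integral_translate c D (fun x => `|f x|)%E) //.
    by move/integrableP : If => [].
  exact: measurableT_comp.
rewrite integralE [RHS]integralE; congr (_ - _)%E.
  rewrite (ge0_integral_translate c mD (measurable_funepos mf)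
    (fun x _ => funepos_ge0 f x)).
  by apply: eq_integral => x _; rewrite !funeposE.
rewrite (ge0_integral_translate c mD (measurable_funeneg mf)
  (fun x _ => funeneg_ge0 f x)).
by apply: eq_integral => x _; rewrite !funenegE.
Qed.

End translation.

Section periodicity.
Variables (R : realType) (X : completeNormedModType R).
Variable ip : {dot X for @idfun R}.

(** A weak integral is characterised by real integrals, so it is enough to
    translate those, in both directions. *)
Lemma vintegral_translate (c a : R) (F G : R -> X) :
  (forall r, r <= a -> F (r + c) = G r) ->
  vintegral ip `]-oo, a + c] F = vintegral ip `]-oo, a] G.
Proof.
move=> FG.
have half (u v b : R) (f g : R -> R) : v = b + u ->
    (forall r, r <= b -> f (r + u) = g r) ->
    lebesgue_measure.-integrable `]-oo, v] (EFin \o f) ->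
    lebesgue_measure.-integrable `]-oo, b] (EFin \o g) /\
    \int[lebesgue_measure]_(r in `]-oo, v]) f r =
      \int[lebesgue_measure]_(r in `]-oo, b]) g r.
  move=> vE fg If.
  have [] := @integrable_translate R u _ _ (measurable_itv _) If.
  have -> : (fun x => x + u) @^-1` `]-oo, v] = `]-oo, b]%classic.
    by apply/seteqP; split=> x; rewrite /= !in_itv /= vE lerD2r.
  move=> Ig Eg.
  have gE x : x \in (`]-oo, b]%classic : set R) -> (f (x + u))%:E = (g x)%:E.
    by rewrite inE /= in_itv /= => xb; rewrite fg.
  split.
    by move: Ig; apply: eq_integrable; [exact: measurable_itv|exact: gE].
  by rewrite /Rintegral Eg; congr fine; exact: eq_integral.
rewrite /vintegral; congr xget; apply/seteqP; split=> v /= vP y;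
  have [Iy vy] := vP y; rewrite vy.
  have [|||I E] :=
    @half c (a + c) a (fun r => ip (F r) y) (fun r => ip (G r) y).
  - by [].
  - by move=> r ra; rewrite FG.
  - exact: Iy.
  - by split.
have [|||I E] :=
  @half (- c) a (a + c) (fun r => ip (G r) y) (fun r => ip (F r) y).
- by rewrite addrK.
- by move=> r ra; rewrite -FG ?subrK // lerBlDr.
- exact: Iy.
- by split.
Qed.

Variables (DA : R -> set X) (A : R -> X -> X).
Variables (U : R -> R -> {linear X -> X}) (B : R -> {linear X -> X}) (T : R).
Hypothesis hper : periodic_system DA A U B T.

Lemma cov_inf_periodic t : cov_inf ip U B (t + T) = cov_inf ip U B t.
Proof.
apply/funext => x; apply: vintegral_translate => r rt.
have UE : (U (t + T) (r + T) : X -> X) = U t r.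
  by apply/funext => y; exact: (per_U hper).
have BE : (B (r + T) : X -> X) = B r.
  by apply/funext => y; exact: (per_B hper).
by rewrite UE BE.
Qed.

Lemma OU_measure_periodic t : OU_measure ip U B (t + T) = OU_measure ip U B t.
Proof. by rewrite /OU_measure cov_inf_periodic. Qed.

End periodicity.

(** Once the two measures are equal, an element of the subspace of mean zero is
    itself a legitimate argument of [P]. *)
Lemma restriction_contraction d (T : measurableType d) (R : realType)
    (mu nu : probability T R) (p : R) (p1 : (1 <= p%:E)%E)
    (P : {linear Lp nu p1 -> Lp mu p1})
    (S : {linear ImPi mu p1 -> ImPi mu p1}) :
  nu = mu -> (opnorm P <= 1)%E ->
  (forall (f : ImPi mu p1) (g : Lp nu p1), g = ImPi_val f %[ae mu] ->
    (P g : Lp mu p1) = ImPi_val (S f) %[ae mu]) ->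
  forall f, `|S f| <= `|f|.
Proof.
move=> numu; subst nu => P1 PS f.
rewrite !ImPi_normE.
have /Lp_eqP <- : (P (ImPi_val f) : Lp mu p1) = ImPi_val (S f) %[ae mu].
  exact: PS (ae_eq_refl _ _ _).
rewrite -[leRHS]mul1r; apply: opnormP P1 _ => r v.
exact: linearZ.
Qed.

Theorem proposition45 (R : realType) (X : completeNormedModType R)
  (ip : {dot X for @idfun R})
  (DA : R -> set X) (A : R -> X -> X)
  (U : R -> R -> {linear X -> X}) (B : R -> {linear X -> X})
  (hsys : standing_assumptions ip DA A U B)
  (p : R) (hp : 1 < p)
  (T : R) (hT : 0 < T) (hper : periodic_system DA A U B T)
  (P0T : {linear Lp (OU_measure ip U B T) (exponent_ge1 hp) ->
                 Lp (OU_measure ip U B 0) (exponent_ge1 hp)})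
  (hP0T : is_OU_extension (s := 0) (t := T) P0T)
  (P0 : {linear ImPi (OU_measure ip U B 0) (exponent_ge1 hp) ->
                ImPi (OU_measure ip U B 0) (exponent_ge1 hp)})
  (hP0 : is_restriction (s := 0) (t := T) P0T P0)
  (hR0 : 0 < spectral_radius P0)
  (hss : forall l, spectrum P0 l ->
     ComplexField.Normc.normc l = spectral_radius P0 -> semisimple P0 l) :
  exists C : R, 0 < C /\
    exists N0 : nat, (0 < N0)%N /\
      forall N : nat, (N0 <= N)%N ->
        (opnorm (iter N P0) <= (C * spectral_radius P0 ^+ N)%:E)%E.
Proof.
have muT : OU_measure ip U B T = OU_measure ip U B 0.
  by rewrite -[T in LHS]add0r; exact: (OU_measure_periodic ip hper).
have P0_le f : `|P0 f| <= 1 * `|f|.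
  by rewrite mul1r; apply: (restriction_contraction muT hP0T.1); exact: hP0.
have [C C0 hC] :=
  power_bound_spectral_radius (@ImPi_complete _ _ _ _ _ _) P0_le hR0 hss.
exists C; split; first exact: C0.
(* The bound holds for every N; any positive threshold will do. *)
exists 1%N; split; first exact: isT.
by move=> N _; exact: hC.
Qed.
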